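(* Let $n\ge 2$ and let $M=\mathrm{CM}(\mathrm{SD}_{8n},X,p)$ be a regular Cayley map of skew-type $3$ on the semidihedral group $\mathrm{SD}_{8n}=\langle a,b\mid a^{4n}=b^2=1,\ bab^{-1}=a^{2n-1}\rangle$. Then $n$ is divisible by $3$ and, up to isomorphism, $M$ belongs to one of the following two families: (a) For $n=3$: $M\cong \mathrm{CM}(\mathrm{SD}_{24},X,p)$, where $$X=\{a,a^3,a^5,a^7,a^9,a^{11},ab,a^3b,a^5b,a^7b,a^9b,a^{11}b\}$$ and $$p=(a^3,\,ab,\,a^5,\,a^3b,\,a^7,\,a^5b,\,a^9,\,a^7b,\,a^{11},\,a^9b,\,a,\,a^{11}b).$$ (b) For all $n$ divisible by $3$: $M\cong M(n;t):=\mathrm{CM}(\mathrm{SD}_{8n},X,p)$, where $t\in\mathbb{Z}_{4n}^*$ has odd multiplicative order $k:=o_{4n}(t)$ modulo $4n$ and satisfies $t\equiv 1\pmod 6$, and $X=\{x_i\}_{0\le i<4k}$, $p=(x_0,x_1,\dots,x_{4k-1})$ with $$x_i=\begin{cases} a^{t^i}, & i\equiv 0\pmod 4,\\ a^{-t^i}, & i\equiv 1\pmod 4,\\ a^{t^i+3}b, & i\equiv 2\pmod 4,\\ a^{-t^i+3+2n}b, & i\equiv 3\pmod 4.\end{cases}$$ Moreover, maps from distinct families, or from the same family with distinct parameters, are mutually non-isomorphic.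
   Context: All groups are finite. A skew morphism on a group $G$ is a permutation $\varphi$ of $G$ with $\varphi(1_G)=1_G$ for which there is a function $\pi:G\to\mathbb{Z}_{|\varphi|}$ (the power function; $|\varphi|$ is the order of $\varphi$ as a permutation) such that $\varphi(gh)=\varphi(g)\varphi^{\pi(g)}(h)$ for all $g,h\in G$. Its kernel is the subgroup $\mathrm{Ker}\,\varphi=\{g\in G\mid \pi(g)\equiv 1 \pmod{|\varphi|}\}$, and its skew-type is the index $[G:\mathrm{Ker}\,\varphi]$. Let $X\subseteq G\setminus\{1_G\}$ be an inverse-closed generating set of $G$ and let $p$ be a cyclic permutation of $X$ (a single cycle of length $|X|$). The Cayley map $\mathrm{CM}(G,X,p)$ is the embedding of the Cayley graph $\mathrm{Cay}(G,X)$ in an orientable closed surface whose local rotation is $\rho(g,gx)=(g,g\,p(x))$ for $g\in G$, $x\in X$. Its automorphisms are the permutations of the arcs $(g,gx)$ commuting with $\rho$ and with the arc reversal $(g,gx)\mapsto(gx,g)$; the map is regular if its automorphism group acts transitively on arcs. By a theorem of Jajcay and Širáň, $\mathrm{CM}(G,X,p)$ is regular if and only if there is a skew morphism $\varphi$ on $G$ with $\varphi|_X=p$ (necessarily unique); the skew-type of the regular map is the skew-type of this $\varphi$. Isomorphism of Cayley maps: $\mathrm{CM}(G,X,p)\cong\mathrm{CM}(H,Y,q)$ means there is a group isomorphism $\delta:G\to H$ with $\delta(X)=Y$ and $q(\delta(x))=\delta(p(x))$ for all $x\in X$. The parameters of the family in (b) are the pairs $(n,t)$. *)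

(* Defs.v *)
From HB Require Import structures.
From mathcomp Require Import all_boot all_algebra all_fingroup all_solvable.
From mathcomp Require Import zify.

Set Implicit Arguments.
Unset Strict Implicit.
Unset Printing Implicit Defensive.

Import GRing.Theory.

Local Open Scope group_scope.

(** * Skew morphisms *)

(* The power function takes values in 'I_#[phi], i.e. in the residues modulo  *)
(* the order of phi.                                                          *)
Record skew_morphism (gT : finGroupType) := SkewMorphism {
  skew_perm :> {perm gT};
  skew_pow : gT -> 'I_#[skew_perm];
  skew1 : skew_perm 1 = 1;
  skewM : forall g h : gT,
    skew_perm (g * h) = skew_perm g * (skew_perm ^+ skew_pow g) h
}.

Definition skew_ker (gT : finGroupType) (phi : skew_morphism gT) : {set gT} :=
  [set g | skew_pow phi g == 1 %[mod #[skew_perm phi]]].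

Lemma skew_kerP (gT : finGroupType) (phi : skew_morphism gT) g :
  reflect (forall h, phi (g * h) = phi g * phi h) (g \in skew_ker phi).
Proof.
rewrite inE -eq_expg_mod_order expg1; apply: (iffP eqP) => [E h | E].
  by rewrite skewM E.
by apply/permP => h; apply: (mulgI (phi g)); rewrite -skewM.
Qed.

Lemma skew_ker_group_set (gT : finGroupType) (phi : skew_morphism gT) :
  group_set (skew_ker phi).
Proof.
apply/group_setP; split=> [|g h /skew_kerP Eg /skew_kerP Eh].
  by apply/skew_kerP => h; rewrite skew1 !mul1g.
by apply/skew_kerP => x; rewrite -mulgA Eg Eh Eg mulgA.
Qed.

Canonical skew_ker_group gT phi := Group (@skew_ker_group_set gT phi).

Definition skew_index (gT : finGroupType) (phi : skew_morphism gT) : nat :=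
  #|[set: gT] : skew_ker phi|.

(** * Cayley maps *)

(* A pair (X, p); as usual in the library, a permutation of the subset X is a *)
(* permutation of the whole type that moves only elements of X.               *)
Record cayley_data (gT : finGroupType) := CM {
  cm_set : {set gT};
  cm_rot : {perm gT}
}.

Section CayleyMaps.

Variables (gT : finGroupType) (M : cayley_data gT).

Local Notation X := (cm_set M).
Local Notation p := (cm_rot M).

Definition is_cayley_map : bool :=
  [&& 1 \notin X,
      [forall x in X, x^-1 \in X],
      <<X>> == [set: gT],
      perm_on X p
    & [forall x in X, porbit p x == X]].

(* The arc (g, gx) is the pair of its endpoints. *)
Definition cm_arcs : {set gT * gT} := [set d | d.1^-1 * d.2 \in X].

Definition arc_rot (d : gT * gT) : gT * gT := (d.1, d.1 * p (d.1^-1 * d.2)).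

Definition arc_rev (d : gT * gT) : gT * gT := (d.2, d.1).

Definition cm_aut : {set {perm gT * gT}} :=
  [set f | perm_on cm_arcs f &&
    [forall d in cm_arcs,
      (f (arc_rot d) == arc_rot (f d)) && (f (arc_rev d) == arc_rev (f d))]].

Lemma cm_aut_group_set : is_cayley_map -> group_set cm_aut.
Proof.
case/and5P => _ /forall_inP XV _ pX _; apply/group_setP; split.
  rewrite inE perm_on1 /=; apply/forall_inP => d _.
  by rewrite !perm1 !eqxx.
move=> f g; rewrite !inE => /andP[fA /forall_inP fE] /andP[gA /forall_inP gE].
rewrite perm_onM //=; apply/forall_inP => d dA; rewrite !permM.
have fdA : f d \in cm_arcs by rewrite perm_closed.
have /andP[/eqP -> /eqP ->] := fE d dA.
by have /andP[/eqP -> /eqP ->] := gE _ fdA; rewrite !eqxx.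
Qed.

Definition cm_regular : bool := [transitive cm_aut, on cm_arcs | 'P].

(* Meaningful for regular maps: there the skew morphism extending p exists    *)
(* and is unique.                                                             *)
Definition cm_skew_type (k : nat) : Prop :=
  exists phi : skew_morphism gT, {in X, phi =1 p} /\ skew_index phi = k.

End CayleyMaps.

Definition cm_iso (gT hT : finGroupType)
    (M : cayley_data gT) (N : cayley_data hT) : Prop :=
  exists delta : {morphism [set: gT] >-> hT},
    [/\ isom [set: gT] [set: hT] delta,
        delta @: cm_set M = cm_set N
      & {in cm_set M, forall x, cm_rot N (delta x) = delta (cm_rot M x)}].

(* The cyclic permutation (s_0, s_1, ..., s_(m-1)) of the entries of s, which *)
(* are meant to be distinct (undup only makes the definition total).          *)
Definition cycle_perm (T : finType) (s : seq T) : {perm T} :=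
  perm (can_inj (prev_next (undup_uniq s))).

(** * Semidihedral groups *)

(* The library's 'SD_m is documented for m a power of 2 only and does not     *)
(* expose its generators.  Here MkSD i s stands for a^i b^s; see SD_Grp.      *)
Record SD (n : nat) := MkSD { sd_exp : 'Z_(4 * n); sd_ref : bool }.

Section SemiDihedral.

Local Open Scope ring_scope.

Variable n : nat.

Definition SD_pair (g : SD n) : 'Z_(4 * n) * bool := (sd_exp g, sd_ref g).

Definition pair_SD (u : 'Z_(4 * n) * bool) : SD n := MkSD u.1 u.2.

Lemma SD_pairK : cancel SD_pair pair_SD. Proof. by case. Qed.

HB.instance Definition _ := Finite.copy (SD n) (can_type SD_pairK).

(* b a^j b^-1 = a^((2n-1) j) *)
Definition sd_twist (s : bool) (j : 'Z_(4 * n)) : 'Z_(4 * n) :=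
  if s then ((2 * n)%:R - 1) * j else j.

Definition SD_mul (g h : SD n) : SD n :=
  MkSD (sd_exp g + sd_twist (sd_ref g) (sd_exp h)) (sd_ref g (+) sd_ref h).

Definition SD_one : SD n := MkSD 0 false.

Definition SD_inv (g : SD n) : SD n :=
  MkSD (- sd_twist (sd_ref g) (sd_exp g)) (sd_ref g).

Lemma SD_4n0 : (4 * n)%:R = 0 :> 'Z_(4 * n).
Proof.
case: n => [|m]; first by [].
by apply: pchar_Zp; lia.
Qed.

Lemma sd_twistK s : involutive (sd_twist s).
Proof.
move=> j; case: s => //=; rewrite mulrA -expr2 sqrrB1 -mulrnA -natrX.
have -> : ((2 * n) ^ 2 = 4 * n * n)%N by lia.
have -> : (2 * n * 2 = 4 * n)%N by lia.
by rewrite natrM SD_4n0 mul0r subr0 add0r mul1r.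
Qed.

Lemma sd_twistD s i j : sd_twist s (i + j) = sd_twist s i + sd_twist s j.
Proof. by case: s; rewrite //= mulrDr. Qed.

Lemma sd_twist_addb s t j : sd_twist (s (+) t) j = sd_twist s (sd_twist t j).
Proof. by case: s t => [] [] //=; rewrite [RHS](sd_twistK true). Qed.

Lemma SD_mulA : associative SD_mul.
Proof.
by move=> g h k; rewrite /SD_mul /= sd_twistD sd_twist_addb addrA addbA.
Qed.

Lemma SD_mul1 : left_id SD_one SD_mul.
Proof. by case=> i s; rewrite /SD_mul /= add0r. Qed.

Lemma SD_mulV : left_inverse SD_one SD_inv SD_mul.
Proof. by case=> i s; rewrite /SD_mul /= addNr addbb. Qed.

HB.instance Definition _ :=
  Finite_isGroup.Build (SD n) SD_mulA SD_mul1 SD_mulV.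

Definition sda : SD n := MkSD 1 false.

Definition sdb : SD n := MkSD 0 true.

Lemma sdaX k : (sda ^+ k)%g = MkSD k%:R false.
Proof.
elim: k => [|k IH]; first by rewrite expg0.
by rewrite expgS IH mulrS.
Qed.

Lemma sdaV k : (sda ^- k)%g = MkSD (- k%:R) false.
Proof. by rewrite sdaX. Qed.

Lemma SD_elt (g : SD n) : g = (sda ^+ sd_exp g * sdb ^+ sd_ref g)%g.
Proof.
case: g => i [] /=; rewrite sdaX ?expg1 ?expg0 ?mulg1 natr_Zp //.
by congr MkSD; rewrite /= addr0.
Qed.

Lemma SD_gen : <<[set sda; sdb]>>%g = [set: SD n].
Proof.
apply/setP => g; rewrite inE (SD_elt g) groupM // groupX // mem_gen //.
  by rewrite !inE eqxx.
by rewrite !inE eqxx orbT.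
Qed.

End SemiDihedral.

Lemma SD_Grp n : 0 < n ->
  [set: SD n] \isog Grp
    (a : b : a ^+ (4 * n), b ^+ 2, b * a * b^-1 = a ^+ (2 * n).-1).
Proof.
move=> n_gt0; have n4_gt1 : 1 < 4 * n by lia.
apply: intro_isoGrp => [|rT H].
  have a4n : sda n ^+ (4 * n) = 1 by rewrite sdaX SD_4n0.
  have b2 : sdb n ^+ 2 = 1.
    by rewrite expgS expg1; congr MkSD; rewrite /= ?mulr0 ?addr0.
  have ba : sdb n * sda n * (sdb n)^-1 = sda n ^+ (2 * n).-1.
    rewrite sdaX; congr MkSD => /=.
    by rewrite !(mulr0, oppr0) addr0 mulr1 add0r -subn1 natrB //; lia.
  have genE : <[sda n]> <*> <[sdb n]> = [set: SD n].
    by rewrite joing_idl joing_idr -SD_gen.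
  by apply/existsP; exists (sda n, sdb n); rewrite /= a4n b2 ba genE.
case/existsP => -[x y] /= /eqP[defH x4n y2 xy].
have xE i j : x ^+ (i + j : 'Z_(4 * n))%R = x ^+ i * x ^+ j.
  rewrite -expgD -(expg_mod (i + j) x4n) /=; congr (x ^+ (_ %% _)).
  by rewrite Zp_cast.
have xX k : x ^+ (k%:R : 'Z_(4 * n))%R = x ^+ k.
  by rewrite val_Zp_nat // expg_mod.
have yV : y^-1 = y by apply/eqP; rewrite eq_invg_mul -y2.
have yx (i : 'Z_(4 * n)) : y * x ^+ i = x ^+ sd_twist true i * y.
  apply: (mulIg y^-1); rewrite mulgK.
  have -> : y * x ^+ i * y^-1 = (y * x * y^-1) ^+ i.
    by rewrite -!mulgA -{1 3}[y]invgK -!conjgE conjXg.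
  rewrite xy -expgM -(xX ((2 * n).-1 * i)%N) natrM natr_Zp -subn1 natrB //; lia.
pose f (g : SD n) := x ^+ sd_exp g * y ^+ sd_ref g.
have fM : {in [set: SD n] &, {morph f : g h / g * h}}.
  move=> [i s] [j t] _ _; rewrite /f /= xE -!mulgA; congr (_ * _).
  rewrite mulgA; case: s => /=; rewrite ?expg1 ?expg0 ?mul1g //.
  rewrite yx /= -!mulgA; congr (_ * _); case: t => //=.
  by rewrite expg0 expg1 mulg1.
apply/homgP; exists (Morphism fM).
rewrite -(congr1 (fun A : {set SD n} => Morphism fM @* A) (SD_gen n)) morphim_gen ?subsetT //.
rewrite morphimEsub ?subsetT //= imsetU !imset_set1 /f /=.
rewrite expg0 expg1 mul1g mulg1 -defH joing_idl joing_idr.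
by rewrite (_ : x ^+ _ = x) //; exact: (xX 1).
Qed.

(** * The two families *)

Definition family_a : cayley_data (SD 3) :=
  let a := sda 3 in let b := sdb 3 in
  CM [set:: [:: a; a ^+ 3; a ^+ 5; a ^+ 7; a ^+ 9; a ^+ 11;
                a * b; a ^+ 3 * b; a ^+ 5 * b; a ^+ 7 * b; a ^+ 9 * b;
                a ^+ 11 * b]]
     (cycle_perm [:: a ^+ 3; a * b; a ^+ 5; a ^+ 3 * b; a ^+ 7; a ^+ 5 * b;
                     a ^+ 9; a ^+ 7 * b; a ^+ 11; a ^+ 9 * b; a; a ^+ 11 * b]).

(* The admissible t in Z_(4n)^*; #[t] is the multiplicative order.  For n     *)
(* divisible by 3, congruence modulo 6 does not depend on the representative. *)
Definition family_b_param (n : nat) (t : {unit 'Z_(4 * n)}) : bool :=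
  [&& 3 %| n, odd #[t] & (FinRing.uval t : nat) == 1 %[mod 6]].

Definition family_b_elt (n : nat) (t : {unit 'Z_(4 * n)}) (i : nat) : SD n :=
  let a := sda n in let b := sdb n in
  let e := (FinRing.uval t ^ i)%N in
  match i %% 4 with
  | 0 => a ^+ e
  | 1 => a ^- e
  | 2 => a ^+ (e + 3) * b
  | _ => a ^- e * a ^+ (3 + 2 * n) * b
  end.

Definition family_b (n : nat) (t : {unit 'Z_(4 * n)}) : cayley_data (SD n) :=
  let s := mkseq (family_b_elt t) (4 * #[t]) in
  CM [set:: s] (cycle_perm s).

(** * The two families consist of Cayley maps *)

Section CyclePerm.

Variables (T : finType) (s : seq T).

Lemma cycle_permE : uniq s -> cycle_perm s =1 next s.
Proof. by move=> Us x; rewrite permE undup_id. Qed.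

Lemma cycle_perm_on : uniq s -> perm_on [set:: s] (cycle_perm s).
Proof.
move=> Us; apply/subsetP => x; rewrite unfold_in /= cycle_permE // inE.
by apply: contraR => /negPf nsx; rewrite next_nth nsx.
Qed.

Lemma porbit_cycle_perm x :
  uniq s -> x \in s -> porbit (cycle_perm s) x = [set:: s].
Proof.
move=> Us sx; apply/setP => y; rewrite inE.
rewrite -(fconnect_cycle (cycle_next Us) sx).
have iterE k : (cycle_perm s ^+ k) x = iter k (next s) x.
  elim: k => [|k IH]; first by rewrite expg0 perm1.
  by rewrite expgSr permM IH cycle_permE.
apply/porbitP/idP => [[k ->] | /iter_findex <-].
  by rewrite iterE fconnect_iter.
by exists (findex (next s) x y); rewrite iterE.
Qed.

End CyclePerm.

Lemma cycle_cayley_map (gT : finGroupType) (s : seq gT) :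
    uniq s -> 1 \notin s -> {in s, forall x, x^-1 \in s} ->
    <<[set:: s]>> = [set: gT] ->
  is_cayley_map (CM [set:: s] (cycle_perm s)).
Proof.
move=> Us s1 sV genS; apply/and5P; split=> /=.
- by rewrite inE.
- by apply/forall_inP => x; rewrite !inE; apply: sV.
- by rewrite genS.
- exact: cycle_perm_on.
- by apply/forall_inP => x; rewrite inE => sx; rewrite porbit_cycle_perm.
Qed.

Lemma SD_gen_mem n (A : {set SD n}) k :
  sda n \in A -> sda n ^+ k * sdb n \in A -> <<A>> = [set: SD n].
Proof.
move=> Aa Aab; apply/eqP; rewrite eqEsubset subsetT -SD_gen gen_subG.
have Ga : sda n \in <<A>> by apply: mem_gen.
apply/subsetP => x /set2P[] -> //.
by rewrite -(groupMl _ (groupX k Ga)) mem_gen.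
Qed.

Lemma family_a_cayley_map : is_cayley_map family_a.
Proof.
pose a := sda 3; pose b := sdb 3.
pose s := [:: a ^+ 3; a * b; a ^+ 5; a ^+ 3 * b; a ^+ 7; a ^+ 5 * b;
              a ^+ 9; a ^+ 7 * b; a ^+ 11; a ^+ 9 * b; a; a ^+ 11 * b].
have -> : family_a = CM [set:: s] (cycle_perm s).
  congr CM; apply/setP => x; rewrite !inE.
  by do 12!case: (x == _) => //=.
apply: cycle_cayley_map; [by vm_compute | by vm_compute | |].
  by apply/allP; vm_compute.
by apply: (@SD_gen_mem 3 _ 1); rewrite inE; vm_compute.
Qed.

Section FamilyB.

Variables (n : nat) (t : {unit 'Z_(4 * n)}).

Hypotheses (n_gt1 : 1 < n) (odd_t : odd #[t]).

Local Open Scope ring_scope.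

Local Notation R := 'Z_(4 * n).
Local Notation k := #[t]%g.

Let u : R := FinRing.uval t.

Lemma family_b_eltE i :
  family_b_elt t i =
  match (i %% 4)%N with
  | 0 => MkSD (u ^+ i) false
  | 1 => MkSD (- u ^+ i) false
  | 2 => MkSD (u ^+ i + 3%:R) true
  | _ => MkSD (- u ^+ i + (3 + 2 * n)%:R) true
  end.
Proof.
have uE : (FinRing.uval t ^ i)%:R = u ^+ i :> R by rewrite natrX natr_Zp.
rewrite /family_b_elt; case: (i %% 4)%N => [|[|[|m]]].
- by rewrite sdaX uE.
- by rewrite sdaV uE.
- by rewrite sdaX; congr MkSD; rewrite /= addr0 natrD uE.
- by rewrite sdaV sdaX; congr MkSD; rewrite /= addr0 uE.
Qed.

Lemma family_b_eqX i j : (u ^+ i == u ^+ j) = (i == j %[mod k])%N.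
Proof.
have uX m : u ^+ m = FinRing.uval (t ^+ m)%g.
  by elim: m => [|m IH]; rewrite ?expr0 ?expg0 // exprS expgS IH.
by rewrite -eq_expg_mod_order !uX (inj_eq val_inj).
Qed.

Lemma family_b_natr_neq0 m : (0 < m < 8)%N -> m%:R != 0 :> R.
Proof.
move=> m_bd; apply/eqP => /(congr1 val) /=.
by rewrite val_Zp_nat ?modn_small //; lia.
Qed.

Lemma family_b_4n : (4 * n)%:R = 0 :> R. Proof. exact: SD_4n0. Qed.

Lemma family_b_neqN i j : u ^+ i != - u ^+ j.
Proof.
have uk m : u ^+ (m * k) = 1 :> R.
  by apply/eqP; rewrite -(expr0 u) family_b_eqX modnMl mod0n.
apply/eqP => /(congr1 (fun x => x ^+ k)); rewrite exprNn -!exprM !uk.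
rewrite -signr_odd odd_t expr1 mulr1 => /eqP.
by rewrite -subr_eq0 opprK -(natrD _ 1 1) (negPf (family_b_natr_neq0 _)).
Qed.

Lemma family_b_neqND i j : u ^+ i != - u ^+ j + (2 * n)%:R.
Proof.
apply/eqP => Eij; have E4 := family_b_4n.
have : u ^+ (i * 2) = u ^+ (j * 2).
  rewrite !exprM Eij sqrrD sqrrN mulNr mulNrn -mulrnAr -mulrnA.
  rewrite (_ : (2 * n * 2 = 4 * n)%N) ?E4 ?mulr0 ?oppr0 ?addr0; last by lia.
  rewrite -natrX (_ : ((2 * n) ^ 2 = 4 * n * n)%N) ?(natrM _ (4 * n) n); last by lia.
  by rewrite E4 mul0r addr0.
move/eqP; rewrite family_b_eqX => Eij2.
have {Eij2} : (i == j %[mod k])%N.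
  have aux x y : (x <= y -> x * 2 == y * 2 %[mod k] -> x == y %[mod k])%N.
    move=> le_xy; rewrite (eq_sym (x * 2 %% k)%N) (eq_sym (x %% k)%N).
    rewrite !eqn_mod_dvd ?leq_mul2r ?le_xy ?orbT //.
    by rewrite -mulnBl Gauss_dvdl // coprimen2.
  case/orP: (leq_total i j) => le_ij; first exact: aux.
  by rewrite eq_sym; apply: aux; rewrite // eq_sym.
rewrite -family_b_eqX => /eqP Eu; move: Eij; rewrite -Eu => /eqP.
rewrite -subr_eq0 opprD opprK addrA subr_eq0 => /eqP E2.
have : (u ^+ i + u ^+ i) * 2%:R = 0.
  by rewrite E2 -natrM (_ : (2 * n * 2 = 4 * n)%N) ?E4 //; lia.
rewrite -mulr2n -(mulr_natr (u ^+ i)) -mulrA -natrM => /eqP.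
have uU : u ^+ i \is a GRing.unit by rewrite unitrX // (valP t).
by rewrite -[X in _ == X](mulr0 (u ^+ i)) (inj_eq (mulrI uU)) (negPf (family_b_natr_neq0 _)).
Qed.

Lemma MkSD_inj (i j : R) r s : MkSD i r = MkSD j s -> i = j /\ r = s.
Proof. by case. Qed.

Lemma family_b_inj : {in gtn (4 * k) &, injective (family_b_elt t)}.
Proof.
move=> i j; rewrite !inE => lti ltj Eij.
suff [E4 Ek] : (i %% 4 = j %% 4 /\ i = j %[mod k])%N.
  have co : coprime 4 k by rewrite (@coprimeXl 2 2) ?coprime2n.
  have : (i == j %[mod 4 * k])%N by rewrite chinese_remainder // E4 Ek !eqxx.
  by rewrite !modn_small // => /eqP.
move: Eij; rewrite !family_b_eltE.
move: (ltn_pmod i (isT : 0 < 4)%N) (ltn_pmod j (isT : 0 < 4)%N).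
have eqX x y : u ^+ x = u ^+ y -> x = y %[mod k].
  by move/eqP; rewrite family_b_eqX => /eqP.
have neqN x y : u ^+ x = - u ^+ y -> False.
  by move/eqP; rewrite (negPf (family_b_neqN _ _)).
have neqND x y : u ^+ x + 3%:R = - u ^+ y + (3 + 2 * n)%:R -> False.
  rewrite (natrD _ 3 (2 * n)) (addrC 3%:R) (addrA (- u ^+ y)) => /addIr/eqP.
  by rewrite (negPf (family_b_neqND _ _)).
case: (i %% 4)%N => [|[|[|[|a]]]] //; case: (j %% 4)%N => [|[|[|[|c]]]] // _ _ /MkSD_inj[] // + _.
- by move/eqX.
- by move/neqN.
- by move/esym/neqN.
- by move/oppr_inj/eqX.
- by move/addIr/eqX.
- by move/neqND.
- by move/esym/neqND.
- by move/addIr/oppr_inj/eqX.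
Qed.

Lemma family_b_uniq : uniq (mkseq (family_b_elt t) (4 * k)).
Proof.
by rewrite map_inj_in_uniq ?iota_uniq // => i j; rewrite !mem_iota; apply: family_b_inj.
Qed.

Lemma family_b_mem r i : (r < 4)%N ->
  exists j, [/\ (j < 4 * k)%N, (j %% 4 = r)%N & u ^+ j = u ^+ i].
Proof.
move=> r_lt; have co : coprime 4 k by rewrite (@coprimeXl 2 2) ?coprime2n.
exists (chinese 4 k r i %% (4 * k))%N; split.
- by rewrite ltn_pmod // muln_gt0 order_gt0.
- by rewrite modn_dvdm ?dvdn_mulr // chinese_modl // modn_small.
apply/eqP; rewrite family_b_eqX modn_dvdm ?dvdn_mull //.
by rewrite chinese_modr.
Qed.

Lemma family_b_2n i : (2 * n)%:R * u ^+ i = (2 * n)%:R.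
Proof.
have odd_u : odd (FinRing.uval t).
  have : coprime (4 * n) (FinRing.uval t).
    by rewrite -unitZpE ?natr_Zp ?(valP t) //; lia.
  rewrite -coprime2n; apply: coprime_dvdl.
  by rewrite (_ : (4 * n = 2 * (2 * n))%N) ?dvdn_mulr //; lia.
have oE v : odd v -> (2 * n * v)%:R = (2 * n)%:R :> R.
  move=> odd_v; have -> : (2 * n * v = 2 * n + 4 * n * v./2)%N.
    by rewrite -[in LHS](odd_double_half v) odd_v; lia.
  by rewrite natrD (natrM _ (4 * n)) family_b_4n mul0r addr0.
elim: i => [|i IH]; first by rewrite mulr1.
by rewrite exprSr mulrA IH -[u]natr_Zp -natrM oE.
Qed.

Lemma family_b_invol (e : R) :
  (2 * n)%:R * e = 0 -> ((MkSD e true : SD n)^-1)%g = MkSD e true.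
Proof. by move=> E; congr MkSD; rewrite /= mulrBl E mul1r sub0r opprK. Qed.

Lemma family_b_cayley_map : is_cayley_map (family_b t).
Proof.
apply: cycle_cayley_map; first exact: family_b_uniq.
- apply/mapP => -[i _]; rewrite family_b_eltE.
  have u_neq0 : (u ^+ i == 0) = false.
    have /unitrX : u \is a GRing.unit := valP t.
    by move/(_ i) => uU; apply/negP => /eqP u0; rewrite u0 unitr0 in uU.
  case: (i %% 4)%N => [|[|[|m]]] /MkSD_inj[/esym/eqP + //].
    by rewrite u_neq0.
  by rewrite oppr_eq0 u_neq0.
- have memE r i (lt_r : (r < 4)%N) : exists2 j, (j < 4 * k)%N &
      (j %% 4 = r)%N /\ u ^+ j = u ^+ i.
    by have [j []] := family_b_mem i lt_r; exists j.
  have fE x j : (j < 4 * k)%N -> x = family_b_elt t j ->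
      x \in mkseq (family_b_elt t) (4 * k).
    by move=> lt_j ->; rewrite map_f // mem_iota.
  move=> _ /mapP[i + ->]; rewrite mem_iota => /= lt_i.
  have := family_b_eltE i; case Ei: (i %% 4)%N => [|[|[|m]]] E.
  + have [j lt_j [jr Ej]] := memE 1%N i isT.
    by apply: (fE _ j lt_j); rewrite E family_b_eltE jr Ej.
  + have [j lt_j [jr Ej]] := memE 0%N i isT.
    apply: (fE _ j lt_j); rewrite E family_b_eltE jr Ej.
    by congr MkSD; rewrite /= opprK.
  + apply: (fE _ i lt_i); rewrite E family_b_invol // mulrDr family_b_2n.
    rewrite -natrM -natrD (_ : (_ + _ = 4 * n * 2)%N); last by lia.
    by rewrite (natrM _ (4 * n)) family_b_4n mul0r.
  + apply: (fE _ i lt_i); rewrite E family_b_invol // mulrDr mulrN family_b_2n.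
    rewrite -natrM.
    have -> : (2 * n * (3 + 2 * n) = 2 * n + 4 * n * n.+1)%N by nia.
    by rewrite (natrD _ (2 * n)) (natrM _ (4 * n)) family_b_4n mul0r addr0 addNr.
apply: (@SD_gen_mem n _ (FinRing.uval t ^ 2 + 3)); rewrite inE; apply/mapP.
  by exists 0%N => //; rewrite mem_iota /= muln_gt0 order_gt0.
by exists 2%N => //; rewrite mem_iota /=; have := order_gt0 t; lia.
Qed.

End FamilyB.

(* Main.v *)
Require Import Defs.
From mathcomp Require Import all_boot all_algebra all_fingroup all_solvable.
From mathcomp Require Import zify ring.

Set Implicit Arguments.
Unset Strict Implicit.
Unset Printing Implicit Defensive.

Import GRing.Theory.

(** Let f be the permutation underlying the skew morphism of M, and X the
orbit of f carrying M.  The kernel K has index 3, so 3 divides n and K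
contains a^3 and a reflection of order two (a reflection being any a^i b);
an automorphism of SD_8n moves that reflection to b.  Hence
f (k g) = f k * f g for k = a^3 and k = b, and f is determined by its values
at a, a^2, a^3 and b.

The power function enters through one consequence only: for fixed g, the map
h |-> f(g)^-1 f(g h) is a power of f, so it commutes with f.  This
commutation, together with the facts that X is inverse-closed and generates
the group, is all that [skew_orbit] retains, and it suffices.

Suppose first that f (a^3) is a rotation (a power of a).  Then f permutes
<a^3> by a^(3 i) |-> a^(3 r i) and induces a map on the quotient by <a^6>,
a dihedral group of order 12.  The finitely many maps on this quotient that
obey the commutation are enumerated: up to inverting a, the orbit X contains
x0 = a^e0 with x1 = f x0 = a^-e1 and f x1 = a^(3 g) b, where e0 and e1 are
1 modulo 6 (modulo <a^3> one sees the octahedron as a map on S_3).  From here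
on the argument is linear algebra over Z/4n.  Commutation at (x0, x0),
(x0, x1) and (x1, x0) gives three equations, which amount to
3 (e1 + r e0) = 2n (1 + g) together with a formula for f b
([octahedral_mul], [octahedral_shift]).  The first one says that multiplying
by r on multiples of 3 is multiplying by - t up to 2n, where e1 = e0 t, so
the whole orbit of x0 can be written down ([octahedral_orbit]).  As X
generates, e0 is a unit; as X contains a^-e0, some t^(4 j + 1) is 1, so t
has odd order; and if g were odd, the inverse of f x1 would put 1 + 2n among
the powers of t although 1 + 2n has order 2.  What remains is the
second family.

If f (a^3) is a reflection, then a^3 has order dividing 4, so n = 3, and
a second enumeration, over SD_24 itself, leaves only the first family.

For the last two claims, the entries of order two decide: the first family
has none, while in the second they occupy the positions 2 and 3 modulo 4, so
an isomorphism shifts positions by a multiple of 4, and it then maps a^-t to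
both (a^c)^-t and (a^c)^-t' for a unit c. *)

Local Open Scope ring_scope.

(** * Linear consequences of the commutation *)

(** A substitute for reasoning modulo an ideal: z is the difference written as
a combination of expressions known to vanish, so that both premises are
settled by ring normalisation. *)
Lemma eq_subr_comb (R : pzRingType) (z x y : R) : x - y = z -> z = 0 -> x = y.
Proof. by move=> Exy z0; apply/eqP; rewrite -subr_eq0 Exy z0. Qed.

(** In the application h = 2n in Z/4n, so that h annihilates the even elements
and fixes the odd ones, and eps = 2n - 1 is the exponent by which b acts.  The
three equations compare exponents in the instances (x0, x0), (x0, x1) and
(x1, x0) of the commutation. *)
Section OctahedralEquations.

Variables (R : comNzRingType) (h r e0 e1 p p' q g B : R).
Hypotheses (h2 : 2 * h = 0) (hr : h * r = h).
Hypotheses (he1 : h * e1 = h) (hq : h * q = 0).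
Hypotheses (hp' : h * p' = h).
Hypotheses (q3 : 3 * q = e0 - e1) (p3 : 3 * p = 2 * e0 + e1).
Hypotheses (p3' : 3 * p' = 2 * e1 + e0).
Let eps := h - 1.
Hypothesis eqA : e1 + 3 * r * q =
  B + 3 * eps * g + 3 * r * g + 3 * r ^+ 2 * p + h.
Hypothesis eqB : - e1 + 3 * r * (r * q - q) =
  e1 + (B + 3 * eps * g + 3 * r * q + h + 3 * r * g).
Hypothesis eqD : B + 3 * r * eps * (r * q - g) =
  - (3 * eps * g) + eps * (- e1 - 3 * r * p').

Lemma octahedral_shift :
  B = 3 * g - 3 * r * g + e1 + 3 * r * p' + 3 * r ^+ 2 * q.
Proof.
apply: (@eq_subr_comb _ (
  (B + 3 * r * eps * (r * q - g)
     - (- (3 * eps * g) + eps * (- e1 - 3 * r * p')))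
  - 3 * r ^+ 2 * (h * q) + 3 * g * (h * r - h)
  - (h * e1 - h) - 3 * p' * (h * r - h) - 3 * (h * p' - h) - 2 * (2 * h))).
  rewrite /eps; ring.
by rewrite eqD hq hr he1 hp' h2; ring.
Qed.

Lemma octahedral_mulr : 3 * r * (e1 + r * e0) = h * (1 + g).
Proof.
apply: (@eq_subr_comb _ (
  - (e1 + 3 * r * q - (B + 3 * eps * g + 3 * r * g + 3 * r ^+ 2 * p + h))
  - (B - (3 * g - 3 * r * g + e1 + 3 * r * p' + 3 * r ^+ 2 * q))
  - r * (3 * p' - (2 * e1 + e0)) + r * (3 * q - (e0 - e1))
  - r ^+ 2 * (3 * p - (2 * e0 + e1)) - r ^+ 2 * (3 * q - (e0 - e1))
  - (2 * h) * (1 + 2 * g))).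
  rewrite /eps; ring.
by rewrite eqA -octahedral_shift q3 p3 p3' h2; ring.
Qed.

(** The difference of the first two equations is 3 (1 - r) (e1 + r e0) = 0,
so the factor r of the previous lemma can be dropped. *)
Lemma octahedral_mul : 3 * (e1 + r * e0) = h * (1 + g).
Proof.
rewrite -octahedral_mulr.
apply: (@eq_subr_comb _ (
  (e1 + 3 * r * q - (B + 3 * eps * g + 3 * r * g + 3 * r ^+ 2 * p + h))
  - (- e1 + 3 * r * (r * q - q)
      - (e1 + (B + 3 * eps * g + 3 * r * q + h + 3 * r * g)))
  + r ^+ 2 * (3 * p - (2 * e0 + e1)) + r ^+ 2 * (3 * q - (e0 - e1))
  - 3 * r * (3 * q - (e0 - e1)))).
  rewrite /eps; ring.
by rewrite eqA eqB q3 p3; ring.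
Qed.

End OctahedralEquations.

(** * Orbits of skew morphisms *)

Section Orbits.

Variable gT : finGroupType.

(** What the proof keeps of a skew morphism f and of the orbit X of f
underlying a regular Cayley map.  [so_comm] holds because
h |-> f(g)^-1 f(g h) is a power of f. *)
Record skew_orbit (f : gT -> gT) (X : {set gT}) : Prop := SkewOrbit {
  so_inj : injective f;
  so_comm : forall g h, f ((f g)^-1 * f (g * h))%g = ((f g)^-1 * f (g * f h))%g;
  so_orbit : forall x y, x \in X -> (y \in X <-> exists i, y = iter i f x);
  so_inv : forall x, x \in X -> (x^-1)%g \in X;
  so_gen : <<X>>%g = [set: gT]
}.

Definition mult_at (f : gT -> gT) (k : gT) : Prop :=
  forall g, f (k * g)%g = (f k * f g)%g.

Lemma mult_at1 f k : mult_at f k -> f 1%g = 1%g.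
Proof. by move=> H; apply: (mulgI (f k)); rewrite mulg1 -H mulg1. Qed.

Lemma skew_orbit_iter f X x i : skew_orbit f X -> x \in X -> iter i f x \in X.
Proof. by move=> H Xx; apply/(so_orbit H _ Xx); exists i. Qed.

(** How generation by X is used: to refute that X lies in a proper subgroup. *)
Lemma skew_orbit_closed f X (P : pred gT) : skew_orbit f X ->
  P 1%g -> (forall g h, P g -> P h -> P (g * h)%g) -> {in X, forall x, P x} ->
  forall g, P g.
Proof.
move=> H P1 PM PX g; have Pg : group_set [set g | P g].
  by apply/group_setP; split=> [|x y]; rewrite !inE //; apply: PM.
have : g \in <<X>>%g by rewrite (so_gen H) inE.
have /subsetP/(_ g) : (<<X>> \subset Group Pg)%g.
  by rewrite gen_subG; apply/subsetP => x /PX; rewrite inE.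
by rewrite !inE.
Qed.

(** Transport along an isomorphism d with inverse d'. *)
Section Transport.

Variables (d d' : gT -> gT).
Hypotheses (dK : cancel d d') (d'K : cancel d' d).
Hypothesis dM : {morph d : x y / (x * y)%g}.

Lemma iter_conj f i x : iter i (d \o f \o d') (d x) = d (iter i f x).
Proof. by elim: i => //= i ->; rewrite dK. Qed.

Lemma dmorph1 : d 1%g = 1%g.
Proof. by apply: (mulgI (d 1%g)); rewrite -dM !mulg1. Qed.

Lemma dmorphV x : d (x^-1)%g = ((d x)^-1)%g.
Proof. by apply/eqP; rewrite eq_sym eq_invg_mul -dM mulgV dmorph1. Qed.

Lemma mult_at_conj f k : mult_at f k -> mult_at (d \o f \o d') (d k).
Proof.
move=> H g /=; have -> : (d k * g)%g = d (k * d' g)%g by rewrite dM d'K.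
by rewrite !dK H dM.
Qed.

Lemma skew_orbit_conj f X :
  skew_orbit f X -> skew_orbit (d \o f \o d') (d @: X).
Proof.
move=> [inj_f comm_f orb_f inv_f gen_f]; split.
- by move=> x y /= /(can_inj dK) /inj_f /(can_inj d'K).
- move=> g h; rewrite -(d'K g) -(d'K h); move: (d' g) (d' h) => {}g {}h.
  by rewrite /= !dK -!dM -!dmorphV !dK -!dM !dK -comm_f.
- move=> _ y /imsetP[x Xx ->]; split.
    case/imsetP => z /(orb_f _ _ Xx)[i ->] ->; by exists i; rewrite iter_conj.
  by case=> i ->; rewrite iter_conj imset_f //; apply/(orb_f _ _ Xx); exists i.
- by move=> _ /imsetP[x Xx ->]; rewrite -dmorphV imset_f // inv_f.
apply/setP => g; rewrite inE -(d'K g).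
have Pg : group_set [set x | d x \in <<d @: X>>]%g.
  apply/group_setP; split=> [|x y]; rewrite !inE ?dmorph1 ?group1 // dM.
  exact: groupM.
have : d' g \in <<X>>%g by rewrite gen_f inE.
have /subsetP/(_ (d' g)) : (<<X>> \subset Group Pg)%g.
  by rewrite gen_subG; apply/subsetP => x Xx; rewrite inE mem_gen ?imset_f.
by rewrite inE => I /I.
Qed.

End Transport.

End Orbits.

(** * Exponents and automorphisms of the semidihedral group *)

Section Automorphisms.

Variable n : nat.

Local Notation R := 'Z_(4 * n).
Local Notation h := ((2 * n)%:R : R).

Lemma SD_h2 : 2 * h = 0.
Proof. by rewrite -(natrM _ 2) mulnA SD_4n0. Qed.

Lemma SD_hh : h * h = 0.
Proof.
have E : (2 * n * (2 * n) = 4 * n * n)%N by lia.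
by rewrite -natrM E (natrM _ (4 * n)) SD_4n0 mul0r.
Qed.

Lemma SD_hodd x : h * (1 + 2 * x) = h.
Proof. by rewrite mulrDr mulr1 mulrCA mulrA SD_h2 mul0r addr0. Qed.

Lemma SD_parity (x : R) : h * x = 0 \/ h * x = h.
Proof.
rewrite -[x]natr_Zp; move: (nat_of_ord x) => k.
rewrite -(odd_double_half k) natrD -mul2n (natrM _ 2 k./2).
case: (odd k); [right | left].
  by rewrite [(nat_of_bool true)%:R](_ : _ = 1) // SD_hodd.
by rewrite add0r mulrCA mulrA SD_h2 mul0r.
Qed.

(** The affine map a^i b^s |-> a^(u i) (a^v b)^s, an automorphism when u is
a unit and a^v b has order two, that is, v is even. *)
Definition sd_aff (u v : R) (g : SD n) : SD n :=
  MkSD (u * sd_exp g + (if sd_ref g then v else 0)) (sd_ref g).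

Lemma sd_affM u v : h * v = 0 ->
  {morph sd_aff u v : x y / (x * y)%g}.
Proof.
move=> hv [i s] [j t]; congr MkSD; rewrite /=.
case: s => /=; case: t; rewrite /= ?addr0 ?add0r.
- apply: (@eq_subr_comb _ (- (h * v))); [ring | by rewrite hv oppr0].
all: ring.
Qed.

Lemma sd_affK u v : u \is a GRing.unit ->
  cancel (sd_aff u v) (sd_aff u^-1 (- (u^-1 * v))).
Proof.
move=> uU [i s]; congr MkSD => /=; rewrite mulrDr mulrA mulVr // mul1r -addrA.
by case: s; rewrite ?mulr0 ?addrN ?addr0.
Qed.

Lemma sd_affVK u v : u \is a GRing.unit ->
  cancel (sd_aff u^-1 (- (u^-1 * v))) (sd_aff u v).
Proof.
move=> uU [i s]; congr MkSD => /=; rewrite mulrDr mulrA mulrV // mul1r -addrA.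
by case: s; rewrite ?mulr0 ?addr0 // mulrN mulrA mulrV // mul1r addNr addr0.
Qed.

Lemma sd_aff_comp u v u' v' g :
  sd_aff u v (sd_aff u' v' g) = sd_aff (u * u') (u * v' + v) g.
Proof.
case: g => i s; congr MkSD => /=.
by rewrite mulrDr mulrA -addrA; case: s; rewrite ?mulr0 ?addr0.
Qed.

End Automorphisms.

(** * The conclusion of the classification, as a statement on orbits *)

Section Families.

Variable n : nat.

Definition family_a_seq : seq (SD n) :=
  let a := sda n in let b := sdb n in
  ([:: a ^+ 3; a * b; a ^+ 5; a ^+ 3 * b; a ^+ 7; a ^+ 5 * b;
       a ^+ 9; a ^+ 7 * b; a ^+ 11; a ^+ 9 * b; a; a ^+ 11 * b])%g.

(** Keeping n a variable in the first alternative avoids casts between SD n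
and SD 3. *)
Definition in_family (f : SD n -> SD n) (X : {set SD n}) : Prop :=
  exists u v x, [/\ u \is a GRing.unit, (2 * n)%:R * v = 0, x \in X &
   (n = 3 /\
      forall i, sd_aff u v (iter i f x) = nth 1%g family_a_seq (i %% 12))
   \/ exists2 t : {unit 'Z_(4 * n)}, family_b_param t &
        forall i, sd_aff u v (iter i f x) = family_b_elt t i].

Lemma in_family_conj u v f (X : {set SD n}) :
    u \is a GRing.unit -> (2 * n)%:R * v = 0 ->
  in_family (sd_aff u v \o f \o sd_aff u^-1 (- (u^-1 * v)))
            (sd_aff u v @: X) ->
  in_family f X.
Proof.
move=> uU hv [u1 [v1 [_ [u1U hv1 /imsetP[x Xx ->] D]]]].
exists (u1 * u), (u1 * v + v1), x; split=> //.
- by rewrite unitrM u1U.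
- by rewrite mulrDr hv1 mulrCA hv mulr0 addr0.
have E i : sd_aff (u1 * u) (u1 * v + v1) (iter i f x) =
    sd_aff u1 v1 (iter i (sd_aff u v \o f \o sd_aff u^-1 (- (u^-1 * v)))
                         (sd_aff u v x)).
  by rewrite -sd_aff_comp iter_conj //; apply: sd_affK.
case: D => [[n3 D] | [t pt D]]; [left; split=> // i | right; exists t => // i].
  by rewrite E D.
by rewrite E D.
Qed.

Lemma skew_orbit_exists (f : SD n -> SD n) X :
  skew_orbit f X -> exists x, x \in X.
Proof.
move=> S; apply/set0Pn/eqP => X0.
by have /setP/(_ (sdb n)) := so_gen S; rewrite X0 gen0 !inE.
Qed.

End Families.

Section Exponents.

Variable n : nat.
Hypotheses (n_gt1 : (1 < n)%N) (n3 : (3 %| n)%N).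
Local Notation R := 'Z_(4 * n).
Local Notation h := ((2 * n)%:R : R).
Local Notation mu := ((n %/ 3)%:R : R).

Lemma SD_h6 : h = 6 * mu.
Proof.
rewrite -[6]/(6%:R) -natrM; congr _%:R.
by case/dvdnP: n3 => k ->; rewrite mulnK //; lia.
Qed.

Lemma val_nat_mod (M k : nat) : (M %| 4 * n)%N -> ((k%:R : R) %% M = k %% M)%N.
Proof. clear n3 => dM; rewrite val_Zp_nat ?modn_dvdm //; lia. Qed.

Lemma two_add6_neq0 (z : R) : 2 + 6 * z != 0.
Proof.
rewrite -[2]/(2%:R) -[6]/(6%:R) -[z]natr_Zp -natrM -natrD.
apply/eqP => /(congr1 (fun x : R => (x %% 6)%N)); rewrite val_nat_mod //.
  by rewrite mod0n; lia.
by case/dvdnP: n3 => k ->; apply/dvdnP; exists (2 * k)%N; lia.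
Qed.

Lemma SD_h_neq0 : h != 0.
Proof.
by clear n3; apply/eqP => /(congr1 val) /=; rewrite val_Zp_nat ?modn_small //; lia.
Qed.

End Exponents.

(** * The octahedral orbits *)

Section Octahedral.

Variable n : nat.
Hypotheses (n_gt1 : (1 < n)%N) (n3 : (3 %| n)%N).
Local Notation R := 'Z_(4 * n).
Local Notation rot u := (MkSD (n := n) u%R false).
Local Notation rfl u := (MkSD (n := n) u%R true).
(* h is a variable because ring normalisation would expand (2 * n)%:R. *)
Variables (h mu : R).
Hypotheses (hE : h = (2 * n)%:R) (h6 : h = 6 * mu).
Local Notation eps := (h - 1).

Let h2 : 2 * h = 0. Proof. by rewrite hE SD_h2. Qed.
Let hh : h * h = 0. Proof. by rewrite hE SD_hh. Qed.
Let hodd x : h * (1 + 2 * x) = h. Proof. by rewrite hE SD_hodd. Qed.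
Let hev x : h * (2 * x) = 0. Proof. by rewrite mulrCA mulrA h2 mul0r. Qed.

Let rotM x y : (rot x * rot y)%g = rot (x + y). Proof. by []. Qed.
Let rotV x : ((rot x)^-1)%g = rot (- x). Proof. by []. Qed.
Let rot_rfl x y : (rot x * rfl y)%g = rfl (x + y). Proof. by []. Qed.
Let rfl_rot x y : (rfl x * rot y)%g = rfl (x + eps * y).
Proof. by rewrite hE. Qed.
Let rflM x y : (rfl x * rfl y)%g = rot (x + eps * y).
Proof. by rewrite hE. Qed.
Let rflV x : ((rfl x)^-1)%g = rfl (- (eps * x)).
Proof. by rewrite hE. Qed.

Variables (f : SD n -> SD n) (X : {set SD n}).
Hypothesis S : skew_orbit f X.
Variables (r rho B e0 i0 e1 i1 g : R).
Hypotheses (rE : r = 1 + 2 * rho) (e0E : e0 = 1 + 6 * i0) (e1E : e1 = 1 + 6 * i1).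
Hypothesis fN : forall i y, f (rot (3 * i) * y)%g = (rot (3 * r * i) * f y)%g.
Hypothesis fb : mult_at f (rfl 0).
Hypothesis fbE : f (rfl 0) = rfl B.
Hypothesis x0X : rot e0 \in X.
Hypothesis fx0 : f (rot e0) = rot (- e1).
Hypothesis fx1 : f (rot (- e1)) = rfl (3 * g).

Let hr : h * r = h.
Proof. by rewrite rE. Qed.
Let he0 : h * e0 = h.
Proof. by rewrite e0E (_ : 6 * i0 = 2 * (3 * i0)) // mulrA -natrM. Qed.
Let he1 : h * e1 = h.
Proof. by rewrite e1E (_ : 6 * i1 = 2 * (3 * i1)) // mulrA -natrM. Qed.
Let eps2 : eps * eps = 1.
Proof.
apply: (@eq_subr_comb _ (h * h - 2 * h)); first by ring.
by rewrite hh h2 subr0.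
Qed.

(* The values of f on the cosets of <a^3>: f0, f1, f2 for the rotations, and
   g0, g1 for the two classes of reflections that occur below. *)
Let f1 i : f (rot (e0 + 3 * i)) = rot (- e1 + 3 * r * i).
Proof. by rewrite addrC -rotM fN fx0 rotM addrC. Qed.
Let f2 i : f (rot (- e1 + 3 * i)) = rfl (3 * g + 3 * r * i).
Proof. by rewrite addrC -rotM fN fx1 rot_rfl addrC. Qed.
Let f0 i : f (rot (3 * i)) = rot (3 * r * i).
Proof. by rewrite -[rot (3 * i)]mulg1 fN (mult_at1 fb) mulg1. Qed.
Let ref_f y : f (rfl y) = (rfl B * f (rot (eps * y)))%g.
Proof. by rewrite -fbE -fb rfl_rot add0r mulrA eps2 mul1r. Qed.
Let g0 i : f (rfl (3 * i)) = rfl (B + 3 * r * i).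
Proof.
rewrite ref_f (_ : eps * _ = 3 * (eps * i)) ?f0 ?rfl_rot; last by ring.
congr MkSD; apply: (@eq_subr_comb _ ((eps * eps - 1) * (3 * r * i))); first by ring.
by rewrite eps2 subrr mul0r.
Qed.
Let g1 i y : eps * y = - e1 + 3 * i ->
  f (rfl y) = rot (B + eps * (3 * g + 3 * r * i)).
Proof. by move=> E; rewrite ref_f E f2 rflM. Qed.

(* The quotients by 3 of 2 e0 + e1, 2 e1 + e0 and e0 - e1. *)
Let p := 1 + 4 * i0 + 2 * i1.
Let p' := 1 + 4 * i1 + 2 * i0.
Let q := 2 * (i0 - i1).

Let p3 : 3 * p = 2 * e0 + e1. Proof. by rewrite e0E e1E /p; ring. Qed.
Let p3' : 3 * p' = 2 * e1 + e0. Proof. by rewrite e0E e1E /p'; ring. Qed.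
Let q3 : 3 * q = e0 - e1. Proof. by rewrite e0E e1E /q; ring. Qed.
Let hq : h * q = 0. Proof. exact: hev. Qed.
Let hp' : h * p' = h.
Proof. by rewrite -[RHS](hodd (2 * i1 + i0)) /p'; ring. Qed.

Let eqA : e1 + 3 * r * q =
  B + 3 * eps * g + 3 * r * g + 3 * r ^+ 2 * p + h.
Proof.
have /esym := so_comm S (rot e0) (rot e0); rewrite fx0 !rotM rotV.
have -> : e0 + e0 = - e1 + 3 * p by rewrite p3; ring.
have -> : e0 - e1 = 3 * q by rewrite q3.
rewrite f0 f2 rotM rot_rfl opprK.
rewrite (@g1 (eps * (g + r * p) + 2 * mu)).
  move=> /MkSD_inj[-> _].
  apply: (@eq_subr_comb _ ((eps * eps - 1) * (3 * r * (g + r * p))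
    + r * eps * (6 * mu - h) + r * (h * h) - (h * r - h) - 2 * h)).
    by ring.
  by rewrite eps2 -h6 hr hh h2; ring.
apply: (@eq_subr_comb _ ((h * e1 - h) - (6 * mu - h))); first by ring.
by rewrite he1 -h6; ring.
Qed.

Let eqB : - e1 + 3 * r * (r * q - q) =
  e1 + (B + 3 * eps * g + 3 * r * q + h + 3 * r * g).
Proof.
have := so_comm S (rot e0) (rot (- e1)); rewrite fx0 fx1 !rotM rotV rot_rfl.
have -> : e0 - e1 = 3 * q by rewrite q3.
rewrite f0 opprK rotM.
have -> : e1 + 3 * r * q = e0 + 3 * (r * q - q).
  by apply: (@eq_subr_comb _ (3 * q - (e0 - e1))); [ring | rewrite q3 subrr].
rewrite f1 (@g1 (- q + 2 * mu + eps * g)).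
  rewrite rotM => /MkSD_inj[-> _].
  apply: (@eq_subr_comb _ ((eps * eps - 1) * (3 * r * g)
    + r * eps * (6 * mu - h) + r * (h * h) - (h * r - h) - 2 * h
    - 3 * r * (h * q))).
    by ring.
  by rewrite eps2 -h6 hr hh h2 hq; ring.
apply: (@eq_subr_comb _
  ((h * e0 - h) - (6 * mu - h) + (3 * q - (e0 - e1)))); first by ring.
by rewrite he0 q3 -h6; ring.
Qed.

Let eqD : B + 3 * r * eps * (r * q - g) =
  - (3 * eps * g) + eps * (- e1 - 3 * r * p').
Proof.
have := so_comm S (rot (- e1)) (rot e0); rewrite fx1 fx0 !rotM rflV.
have -> : - e1 + e0 = 3 * q by rewrite q3 addrC.
have -> : - e1 - e1 = e0 + 3 * (- p').
  by apply: (@eq_subr_comb _ (3 * p' - (2 * e1 + e0))); [ring | rewrite p3' subrr].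
rewrite f0 f1 !rfl_rot.
rewrite (_ : - (eps * (3 * g)) + eps * (3 * r * q) =
             3 * (eps * (r * q - g))); last by ring.
rewrite g0 => /MkSD_inj[E _].
by transitivity (B + 3 * r * (eps * (r * q - g))); [ring | rewrite E; ring].
Qed.

Let BE : B = 3 * g - 3 * r * g + e1 + 3 * r * p' + 3 * r ^+ 2 * q.
Proof. exact: (octahedral_shift h2 hr he1 hq hp' eqD). Qed.
Let rE3 : 3 * (e1 + r * e0) = h * (1 + g).
Proof. exact: (octahedral_mul h2 hr he1 hq hp' q3 p3 p3' eqA eqB eqD). Qed.

(** The quotient e1 / e0, available before e0 is known to be a unit: since
e0 = 1 + 6 i0 and 6 e1 = - 6 r e0, one has
e1 = e0 e1 - 6 i0 e1 = e0 (e1 + 6 r i0). *)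
Definition octahedral_t := e1 + 6 * r * i0.
Local Notation t := octahedral_t.
Local Notation tau := (i1 + r * i0).

Let tE : t = 1 + 6 * tau. Proof. by rewrite /t e1E; ring. Qed.
Let ht : h * t = h.
Proof. by rewrite tE (_ : 6 * tau = 2 * (3 * tau)) // mulrA -natrM. Qed.

Let e1t : e1 = e0 * t.
Proof.
apply: (@eq_subr_comb _ (
  - (2 * i0) * (3 * (e1 + r * e0) - h * (1 + g))
  - 2 * h * (i0 * (1 + g)) - (e0 - (1 + 6 * i0)) * e1)).
  by rewrite /t; ring.
by rewrite rE3 h2 e0E; ring.
Qed.

Let r3 : 3 * r * e0 = - (3 * t * e0) + h * (1 + g).
Proof. by rewrite -rE3 {1}e1t; ring. Qed.

Let D0 : 3 * r * e0 + 3 * t * e0 - h * (1 + g) = 0.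
Proof. by rewrite r3; ring. Qed.
Let T0 : t - (1 + 6 * tau) = 0.
Proof. by rewrite -tE subrr. Qed.
Let E0 : e1 - e0 * t = 0.
Proof. by rewrite -e1t subrr. Qed.

(* Eliminating r: 3 r e0 = - 3 t e0 + h (1 + g), and 2 t + 1, t - 1 are
   multiples of 3. *)
Let BE' : B = 3 * g - 3 * r * g - e0 * t ^+ 2 - e0 * t ^+ 3 + h * (1 + g).
Proof.
have a : r * (2 * e1 + e0) = - (t * (2 * t + 1) * e0) + h * (1 + g).
  apply: (@eq_subr_comb _ (2 * r * (e1 - e0 * t)
    + (2 * r * e0 + 2 * t * e0) * (t - (1 + 6 * tau))
    + (1 + 4 * tau) * (3 * r * e0 + 3 * t * e0 - h * (1 + g))
    + 2 * h * (2 * tau * (1 + g)))); first by ring.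
  by rewrite D0 T0 E0 h2; ring.
have b : r ^+ 2 * (e0 - e1) = t ^+ 2 * e0 - t ^+ 3 * e0.
  apply: (@eq_subr_comb _ (- r ^+ 2 * (e1 - e0 * t)
    - (r ^+ 2 - t ^+ 2) * e0 * (t - (1 + 6 * tau))
    - 2 * tau * (r - t) * (3 * r * e0 + 3 * t * e0 - h * (1 + g))
    - 2 * h * (tau * (r - t) * (1 + g)))); first by ring.
  by rewrite D0 T0 E0 h2; ring.
rewrite BE.
have -> : 3 * r * p' = r * (2 * e1 + e0) by rewrite -p3'; ring.
have -> : 3 * r ^+ 2 * q = r ^+ 2 * (e0 - e1) by rewrite -q3; ring.
by rewrite a b e1t; ring.
Qed.

(* The four kinds of steps of f along the orbit; y stands for a power of t,
   and all of these are 1 modulo 6. *)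
Let step0 y z : y = 1 + 6 * z -> f (rot (e0 * y)) = rot (- (e0 * (t * y))).
Proof.
move=> ->; rewrite (_ : e0 * _ = e0 + 3 * (2 * e0 * z)) ?f1; last by ring.
congr MkSD; apply: (@eq_subr_comb _ (- (e1 - e0 * t)
  + 2 * z * (3 * r * e0 + 3 * t * e0 - h * (1 + g))
  + 2 * h * (z * (1 + g)))); first by ring.
by rewrite D0 E0 h2; ring.
Qed.

Let step1 y z : y = 1 + 6 * z ->
  f (rot (- (e0 * y))) = rfl (3 * g - e0 * t ^+ 2 + e0 * (t * y)).
Proof.
move=> ->; rewrite (_ : - _ = - e1 + 3 * (2 * e0 * (tau - z))) ?f2; last first.
  apply: (@eq_subr_comb _ ((e1 - e0 * t) + e0 * (t - (1 + 6 * tau)))).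
    by ring.
  by rewrite T0 E0; ring.
congr MkSD; apply: (@eq_subr_comb _ (
  2 * (tau - z) * (3 * r * e0 + 3 * t * e0 - h * (1 + g))
  + e0 * t * (t - (1 + 6 * tau))
  + 2 * h * ((tau - z) * (1 + g)))); first by ring.
by rewrite D0 T0 h2; ring.
Qed.

Let s := 2 * tau + 6 * tau ^+ 2.
Let s0 : t ^+ 2 - (1 + 6 * s) = 0.
Proof. by rewrite tE /s; ring. Qed.

Let step2 y z : y = 1 + 6 * z -> f (rfl (3 * g - e0 * t ^+ 2 + e0 * y)) =
  rfl (3 * g - e0 * t ^+ 2 - e0 * (t * y) + h * (1 + g)).
Proof.
move=> ->; rewrite (_ : _ + _ = 3 * (g + 2 * e0 * (z - s))) ?g0; last first.
  apply: (@eq_subr_comb _ (- e0 * (t ^+ 2 - (1 + 6 * s)))); first by ring.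
  by rewrite s0 mulr0.
congr MkSD; rewrite BE'; apply: (@eq_subr_comb _ (
  2 * (z - s) * (3 * r * e0 + 3 * t * e0 - h * (1 + g))
  - e0 * t * (t ^+ 2 - (1 + 6 * s))
  + 2 * h * ((z - s) * (1 + g)))); first by ring.
by rewrite D0 s0 h2; ring.
Qed.

Let step3 y z : y = 1 + 6 * z ->
  f (rfl (3 * g - e0 * t ^+ 2 - e0 * y + h * (1 + g))) = rot (e0 * (t * y)).
Proof.
move=> yE; pose c := 1 + 2 * (s + z + tau).
have c0 : t ^+ 2 + y + t - 3 * c = 0.
  apply: (@eq_subr_comb _ ((t ^+ 2 - (1 + 6 * s)) + (t - (1 + 6 * tau)))).
    by rewrite yE /c; ring.
  by rewrite s0 T0 addr0.
have hc : h * c = h by exact: hodd.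
have hy : h * y = h by rewrite yE -[RHS](hodd (3 * z)); ring.
rewrite (@g1 (- g + e0 * c - 2 * mu)); last first.
  apply: (@eq_subr_comb _ (- (2 * h) * (1 - g) + (e1 - e0 * t)
   + e0 * (t ^+ 2 + y + t - 3 * c) + (6 * mu - h) + h * h * (1 + g)
   - (h * e0 - h) * (t ^+ 2 + y) - (h * t - h) * (t + 1) - (h * y - h))).
    by ring.
  by rewrite h2 E0 c0 -h6 hh he0 ht hy; ring.
congr MkSD; rewrite BE'.
have -> : 3 * r * (- g + e0 * c - 2 * mu) =
    - (3 * r * g) - 3 * t * e0 * c + h * (1 + g) - h.
  apply: (@eq_subr_comb _ (c * (3 * r * e0 + 3 * t * e0 - h * (1 + g))
    - r * (6 * mu - h) - (h * r - h) + (1 + g) * (h * c - h))); first by ring.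
  by rewrite D0 -h6 hr hc; ring.
apply: (@eq_subr_comb _ (- e0 * t * (t ^+ 2 + y + t - 3 * c)
   + h * h * g - 3 * g * (h * r - h) - 3 * e0 * c * (h * t - h)
   - 3 * c * (h * e0 - h) - 3 * (h * c - h) - 2 * h)).
   by ring.
by rewrite c0 hh hr ht he0 hc h2; ring.
Qed.

Definition octahedral_entry (i : nat) : SD n :=
  match (i %% 4)%N with
  | 0 => rot (e0 * t ^+ i)
  | 1 => rot (- (e0 * t ^+ i))
  | 2 => rfl (3 * g - e0 * t ^+ 2 + e0 * t ^+ i)
  | _ => rfl (3 * g - e0 * t ^+ 2 - e0 * t ^+ i + h * (1 + g))
  end.

Let tX i : exists z, t ^+ i = 1 + 6 * z.
Proof.
elim: i => [|i [z IH]]; first by exists 0; rewrite mulr0 addr0.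
exists (tau + z + 6 * tau * z); rewrite exprS IH tE; ring.
Qed.

Lemma octahedral_orbit i : iter i f (rot e0) = octahedral_entry i.
Proof.
elim: i => [|i IH]; first by rewrite /octahedral_entry /= mulr1.
have [z] := tX i.
rewrite iterS IH /octahedral_entry.
have -> : (i.+1 %% 4 = (i %% 4).+1 %% 4)%N by rewrite -addn1 -modnDml addn1.
have := ltn_pmod i (isT : 0 < 4)%N.
case: (i %% 4)%N => [|[|[|[|k]]]] //= _ E; rewrite (exprS t i).
- exact: step0 E.
- exact: step1 E.
- exact: step2 E.
- exact: step3 E.
Qed.

Let mem_oct x : x \in X -> exists i, x = octahedral_entry i.
Proof. by case/(so_orbit S _ x0X) => i ->; exists i; rewrite octahedral_orbit. Qed.

(* Otherwise X lies in the proper subgroup generated by a^e0 and a^(3 g) b.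
   It contains a^h, because h = e0 h. *)
Let e0U : e0 \is a GRing.unit.
Proof.
pose P (y : SD n) := [exists z, y ==
  MkSD ((if sd_ref y then 3 * g else 0) + e0 * z) (sd_ref y)].
have he : h = e0 * h by rewrite mulrC he0.
have /existsP[z /eqP/MkSD_inj[E _]] : P (rot 1).
  apply: (skew_orbit_closed S).
  - by apply/existsP; exists 0; rewrite /= mulr0 addr0.
  - move=> [i a] [j b] /existsP[z /eqP/MkSD_inj[/= -> _]].
    case/existsP=> w /eqP/MkSD_inj[/= -> _]; apply/existsP.
    case: a b => [] [] /=; rewrite ?rflM ?rfl_rot.
    + exists (z + eps * w + h * (3 * g)); apply/eqP; congr MkSD.
      apply: (@eq_subr_comb _ (- (3 * g) * (h * e0 - h))); first by ring.
      by rewrite he0; ring.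
    + by exists (z + eps * w); apply/eqP; congr MkSD; ring.
    + by exists (z + w); apply/eqP; congr MkSD => /=; ring.
    + by exists (z + w); apply/eqP; congr MkSD => /=; ring.
  move=> x /mem_oct[i ->]; apply/existsP; rewrite /octahedral_entry.
  case: (i %% 4)%N => [|[|[|k]]] /=.
  + by exists (t ^+ i); rewrite add0r.
  + by exists (- t ^+ i); rewrite add0r mulrN.
  + by exists (t ^+ i - t ^+ 2); apply/eqP; congr MkSD; ring.
  + exists (- t ^+ 2 - t ^+ i + h * (1 + g)); apply/eqP; congr MkSD.
    by rewrite !mulrDr !mulrA -he; ring.
by apply/unitrP; exists z; rewrite mulrC -[e0 * z]add0r -E.
Qed.

(* The inverse of a^e0 is in X; it is at a position 1 modulo 4, the rotations
   at the other positions being 1 modulo 6. *)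
Let tpow : exists2 k, (k %% 4 = 1)%N & t ^+ k = 1.
Proof.
have /mem_oct[k] : rot (- e0) \in X by rewrite -rotV (so_inv S).
rewrite /octahedral_entry; have [z E] := tX k.
case Ek: (k %% 4)%N => [|[|[|m]]] /MkSD_inj[] //.
  rewrite E => C; have /eqP[] := two_add6_neq0 n_gt1 n3 z.
  apply: (mulrI e0U); rewrite mulr0.
  by apply: (@eq_subr_comb _ (e0 * (1 + 6 * z) + e0)); [ring | rewrite -C addNr].
by move/oppr_inj => C _; exists k => //; apply: (mulrI e0U); rewrite -C mulr1.
Qed.

Let tU : t \is a GRing.unit.
Proof.
have [[|k] // _ tk] := tpow.
by apply/unitrP; exists (t ^+ k); rewrite -exprSr -exprS.
Qed.

(* If g is odd, the inverse a^(3 g + h) b of a^(3 g) b is in X, so that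
   t^k = t^2 + h for some k.  Then t^(2 k) = t^4, whence t^k = t^2 because t
   has odd order, and h = 0. *)
Let hg0 : h * g = 0.
Proof.
have [] := SD_parity g; rewrite -!hE => hg; first exact: hg.
have hgt : h * (1 + g) = 0 by rewrite mulrDr mulr1 hg -mulr2n -mulr_natl h2.
have x2X : rfl (3 * g) \in X.
  by rewrite -fx1 -fx0; apply: (skew_orbit_iter 2 S x0X).
have /mem_oct[k] : rfl (3 * g + h) \in X.
  have -> : rfl (3 * g + h) = (rfl (3 * g))^-1%g.
    rewrite rflV; congr MkSD.
    apply: (@eq_subr_comb _ (3 * (h * g - h) + (2 * h) * 2)); first by ring.
    by rewrite hg h2; ring.
  by apply: (so_inv S).
have [z E] := tX k.
rewrite /octahedral_entry hgt; case Ek: (k %% 4)%N => [|[|[|m]]] /MkSD_inj[] // C _.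
  have tk1 : t ^+ k = t ^+ 2 + h.
    apply: (mulrI e0U); rewrite mulrDr (mulrC e0 h) he0.
    apply: (addrI (3 * g - e0 * t ^+ 2)); rewrite -C; ring.
  have [l l4 tl] := tpow; have [j lj] : exists j, l.+1 = (2 * j)%N.
    by exists (l.+1 %/ 2)%N; clear -l4; lia.
  have sq x : t ^+ (x * (2 * j)) = t ^+ x.
    by rewrite -lj mulnS exprD (mulnC x) exprM tl expr1n mulr1.
  have tk2 : t ^+ (k * 2) = t ^+ (2 * 2).
    rewrite !exprM tk1.
    apply: (@eq_subr_comb _ (h * h + (2 * h) * t ^+ 2)); first by ring.
    by rewrite hh h2; ring.
  have /eqP[] := SD_h_neq0 n_gt1; rewrite -hE; apply: (addrI (t ^+ 2)).
  rewrite -tk1 addr0 -(sq k) -(sq 2) (mulnA k) (mulnA 2 2)%N.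
  by rewrite (exprM _ (k * 2)) tk2 -exprM.
have /eqP[] := two_add6_neq0 n_gt1 n3 (s + z + mu).
apply: (mulrI e0U); rewrite mulr0.
apply: (@eq_subr_comb _ (3 * g + h - (3 * g - e0 * t ^+ 2 - e0 * t ^+ k + 0)
  - e0 * (t ^+ 2 - (1 + 6 * s)) + (h * e0 - h) - e0 * (t ^+ k - (1 + 6 * z))
  + e0 * (6 * mu - h))).
  by ring.
by rewrite C s0 he0 E -h6; ring.
Qed.

(** The automorphism sends a^e0 to a; its shift makes the reflection
a^(3 g) b at position 2 equal to a^(t^2 + 3) b. *)
Lemma octahedral_in_family : in_family f X.
Proof.
have [k k4 tk] := tpow.
pose T : {unit R} := FinRing.unit R tU.
have TX m : FinRing.uval (T ^+ m)%g = t ^+ m.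
  by elim: m => [|m IH]; rewrite ?expr0 ?expg0 // exprS expgS -IH.
have heV : h * e0^-1 = h by rewrite -{1}he0 mulrK.
exists e0^-1, (3 + t ^+ 2 - e0^-1 * (3 * g)), (rot e0); split=> //.
- by rewrite unitrV.
- rewrite -hE; apply: (@eq_subr_comb _ ((2 * h) * 2 + (h * t - h) * (t + 1)
    - 3 * g * (h * e0^-1 - h) - 3 * (h * g))); first by ring.
  by rewrite h2 ht heV hg0; ring.
right; exists T.
  have oT : (#[T]%g %| k)%N.
    by rewrite order_dvdn; apply/eqP/val_inj; rewrite [LHS]TX tk.
  apply/and3P; split=> //.
    by apply: dvdn_odd oT _; lia.
  have : (t %% 6 = 1)%N.
    rewrite tE -[6]/(6%:R) -[1]/(1%:R) -[tau]natr_Zp -natrM -natrD.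
    rewrite val_nat_mod //; first lia.
    by move: n3 => /dvdnP[m ->]; apply/dvdnP; exists (2 * m)%N; lia.
  by move=> ->.
move=> i; rewrite octahedral_orbit family_b_eltE /octahedral_entry.
rewrite -[FinRing.uval T]/t.
case: (i %% 4)%N => [|[|[|m]]]; congr MkSD => /=.
- by rewrite addr0 mulKr.
- by rewrite addr0 mulrN mulKr.
- by rewrite mulrDr mulKr // mulrBr mulKr // -[3%:R]/3; ring.
rewrite natrD -hE mulrDr mulrBr mulKr // mulrBr mulKr //.
apply: (@eq_subr_comb _ ((h * e0^-1 - h) * (1 + g) + h * g)); first by ring.
by rewrite heV hg0; ring.
Qed.

End Octahedral.

(** * Enumeration of the small cases *)

Local Close Scope ring_scope.

(** The code (e, s) stands for a^e b^s with exponents modulo M.  The twist by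
2n - 1 is coded as multiplication by 5, which is right both for M = 6 and
n divisible by 3, and for M = 12 and n = 3. *)
Section Codes.

Variable M : nat.

Definition code_twist (s : bool) (e : nat) := if s then 5 * e else e.

Definition code_mul (g h : nat * bool) : nat * bool :=
  ((g.1 + code_twist g.2 h.1) %% M, g.2 (+) h.2).

(** The multiple of M only keeps the truncated subtraction exact. *)
Definition code_inv (g : nat * bool) : nat * bool :=
  ((5 * M - code_twist g.2 g.1) %% M, g.2).

Definition codes : seq (nat * bool) :=
  [seq (e, s) | s <- [:: false; true], e <- iota 0 M].

(** The map with values A, B, C, D at a^3, b, a, a^2 that is multiplicative at
a^3 and b: the exponent k of the rotation left after extracting b in front is
written 3 i + l with l < 3. *)
Definition code_map (A B C D g : nat * bool) : nat * bool :=
  let k := code_twist g.2 g.1 %% M in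
  let y := code_mul (iter (k %/ 3) (code_mul A) (0, false))
                    (nth (0, false) [:: (0, false); C; D] (k %% 3)) in
  if g.2 then code_mul B y else y.

Definition code_comm (F : nat * bool -> nat * bool) (g : nat * bool) : bool :=
  all (fun h => F (code_mul (code_inv (F g)) (F (code_mul g h)))
                  == code_mul (code_inv (F g)) (F (code_mul g (F h)))) codes.

(** O is contained in none of the subgroups of index 2 and 3, namely <a>,
<a^2, b>, <a^2, a b> and the three groups <a^3, a^i b>. *)
Definition code_spread (O : seq (nat * bool)) : bool :=
  [&& has (fun y : nat * bool => y.2) O,
      has (fun y : nat * bool => odd y.1) O,
      has (fun y : nat * bool => odd y.1 (+) y.2) O
    & all (fun j => has (fun y : nat * bool => (y.1 + y.2 * j) %% 3 != 0) O)
          [:: 0; 1; 2]].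

(** If F satisfies the necessary conditions, then so does post at every orbit
that may come from an inverse-closed generating one.  Conditionals are used
instead of conjunctions so that a call-by-value evaluation stops at the first
failed test.  The length of the orbits is not known in advance; that 2 M
iterates exhaust them is part of what is checked. *)
Definition code_check
    (post : (nat * bool -> nat * bool) -> pred (seq (nat * bool)))
    (F : nat * bool -> nat * bool) : bool :=
  if uniq (map F codes) then
  if code_comm F (1, false) then if code_comm F (2, false) then
    all (fun x => let O := traject F x (2 * M) in
      all (fun y => F y \in O) O &&
      (if all (fun y => code_inv y \in O) O && code_spread O
       then post F O else true)) codes
  else true else true else true.

Definition code_inj (F : nat * bool -> nat * bool) (l : nat) : bool :=
  uniq [seq F g | g <- codes & code_twist g.2 g.1 %% 3 < l].

(** The candidates for D are tried only if the values determined by A, B and C,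
those on the cosets of 1 and a, are distinct. *)
Definition code_search post (LA LB : seq (nat * bool)) : bool :=
  all (fun A => all (fun B =>
    if (code_mul B B == (0, false)) && (code_mul A B == code_mul B A) then
      all (fun C => if code_inj (code_map A B C C) 2 then
        all (fun D => code_check post (code_map A B C D)) codes
      else true) codes
    else true) LB) LA.

End Codes.

(** Some x in the orbit satisfies x = a^e, f x = a^-e, f (f x) = a^(3 g) b
modulo <a^6>, for some sign e. *)
Definition octahedral_mod6 (F : nat * bool -> nat * bool)
    (O : seq (nat * bool)) : bool :=
  has (fun y : nat * bool => [&& F (F y) \in [:: (0, true); (3, true)] &
    ((y == (1, false)) && (F y == (5, false)))
    || ((y == (5, false)) && (F y == (1, false)))]) O.

(** The value at b is a reflection with even exponent, because it has order two
in SD_8n; modulo <a^6> every reflection has order two, so this is information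
that the enumeration could not recover. *)
Lemma search_mod6 :
  code_search 6 octahedral_mod6
    [:: (3, false)] [:: (0, true); (2, true); (4, true)].
Proof. by vm_compute. Qed.

Definition code_aff (u v : nat) (g : nat * bool) : nat * bool :=
  ((u * g.1 + g.2 * v) %% 12, g.2).

Definition code_family_a : seq (nat * bool) :=
  [:: (3, false); (1, true); (5, false); (3, true); (7, false); (5, true);
      (9, false); (7, true); (11, false); (9, true); (1, false); (11, true)].

(** Some automorphism of SD_24 maps the orbit onto the first family. *)
Definition family_a_mod12 (F : nat * bool -> nat * bool)
    (O : seq (nat * bool)) : bool :=
  has (fun y : nat * bool => has (fun u => has (fun v => (iter 12 F y == y) &&
     ([seq code_aff u v z | z <- traject F y 12] == code_family_a))
        [:: 0; 2; 4; 6; 8; 10]) [:: 1; 5; 7; 11]) O.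

Lemma search_mod12 :
  code_search 12 family_a_mod12 [seq (e, true) | e <- iota 0 12] (codes 12).
Proof. by vm_compute. Qed.

Local Open Scope ring_scope.

(** * From orbits to their codes *)

Section Reduction.

Variables (n M : nat).
Hypotheses (n_gt1 : (1 < n)%N) (M_gt1 : (1 < M)%N) (M6 : (6 %| M)%N).
Hypotheses (Mn : (M %| 4 * n)%N) (M2n : (2 * n = 6 %[mod M])%N).
Local Notation R := 'Z_(4 * n).

Definition sd_mod (g : SD n) : nat * bool := ((sd_exp g %% M)%N, sd_ref g).

Lemma sd_mod_nat k s : sd_mod (MkSD k%:R s) = ((k %% M)%N, s).
Proof. by rewrite /sd_mod /= val_nat_mod. Qed.

Lemma SD_nat (g : SD n) : exists k, g = MkSD k%:R (sd_ref g).
Proof. by case: g => i s; exists i; rewrite natr_Zp. Qed.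

Lemma sd_twist_nat s k :
  sd_twist s (k%:R : R) = (if s then (2 * n - 1) * k else k)%N%:R.
Proof. by case: s => //=; rewrite [in RHS]natrM natrB //; lia. Qed.

Lemma twist_mod s k :
  ((if s then (2 * n - 1) * k else k) = code_twist s k %[mod M])%N.
Proof.
case: s => //=; apply/eqP; rewrite -(eqn_modDr k).
have -> : ((2 * n - 1) * k + k = 2 * n * k)%N.
  by rewrite -mulSnr; congr (_ * _)%N; lia.
have -> : (5 * k + k = 6 * k)%N by lia.
by rewrite -modnMml M2n modnMml.
Qed.

Lemma code_twist_mod s k : (code_twist s (k %% M) = code_twist s k %[mod M])%N.
Proof. by case: s; rewrite /code_twist ?modnMmr ?modn_mod. Qed.

Lemma sd_modM x y : sd_mod (x * y)%g = code_mul M (sd_mod x) (sd_mod y).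
Proof.
have [[k ->] [l ->]] := (SD_nat x, SD_nat y).
case: x y => _ s [_ s'] /=.
have -> : (MkSD k%:R s * MkSD l%:R s')%g =
   MkSD (k + if s then (2 * n - 1) * l else l)%N%:R (s (+) s') :> SD n.
  by rewrite natrD -sd_twist_nat.
rewrite !sd_mod_nat /code_mul /=; congr (_, _).
by rewrite modnDml -modnDmr twist_mod -[in RHS]modnDmr code_twist_mod.
Qed.

Lemma sd_mod1 : sd_mod 1%g = (0%N, false).
Proof. by rewrite (_ : 1%g = MkSD 0%:R false) // sd_mod_nat mod0n. Qed.

Lemma sd_modV x : sd_mod (x^-1)%g = code_inv M (sd_mod x).
Proof.
have [k ->] := SD_nat x; case: x => _ s /=; rewrite /code_inv sd_mod_nat /=.
have -> : ((MkSD k%:R s)^-1)%g =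
   MkSD ((4 * n - 1) * (if s then (2 * n - 1) * k else k))%N%:R s :> SD n.
  congr MkSD; rewrite /= sd_twist_nat (natrM _ (4 * n - 1)) natrB; last lia.
  by rewrite SD_4n0 sub0r mulN1r.
rewrite sd_mod_nat; congr (_, _); apply/eqP.
set w := (if s then _ else _).
have w_le : (code_twist s (k %% M) <= 5 * M)%N.
  by have := ltn_pmod k (ltnW M_gt1); case: (s) => /=; lia.
rewrite -(eqn_modDr (code_twist s (k %% M))) subnK // modnMl.
rewrite -modnDmr code_twist_mod -(twist_mod s k) modnDmr -/w.
have -> : ((4 * n - 1) * w + w = 4 * n * w)%N.
  by rewrite -mulSnr; congr (_ * _)%N; lia.
by rewrite -modnMml (eqP Mn) mul0n mod0n.
Qed.
Variables (f : SD n -> SD n) (X : {set SD n}).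
Hypothesis S : skew_orbit f X.
Hypotheses (fa3 : mult_at f (MkSD 3%:R false)) (fb : mult_at f (MkSD 0 true)).
(* This makes the class of f x modulo <a^M> depend on that of x only. *)
Hypothesis faM : sd_mod (f (MkSD M%:R false)) = (0%N, false).
Let A := sd_mod (f (MkSD 3%:R false)).
Let B := sd_mod (f (MkSD 0 true)).
Let C := sd_mod (f (MkSD 1%:R false)).
Let D := sd_mod (f (MkSD 2%:R false)).
Let F := code_map M A B C D.

Let rot_nat k l :
  (MkSD k%:R false * MkSD l%:R false)%g = MkSD (k + l)%N%:R false :> SD n.
Proof. by rewrite natrD. Qed.

Let code_mul1 x : code_mul M (0%N, false) (sd_mod x) = sd_mod x.
Proof. by rewrite -sd_mod1 -sd_modM mul1g. Qed.

Let f_rot3 i l : sd_mod (f (MkSD (3 * i + l)%N%:R false)) =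
  code_mul M (iter i (code_mul M A) (0%N, false)) (sd_mod (f (MkSD l%:R false))).
Proof.
have -> : iter i (code_mul M A) (0%N, false) = sd_mod (f (MkSD 3%:R false) ^+ i)%g.
  by elim: i => [|i IH]; rewrite ?expg0 ?sd_mod1 // iterS IH expgS sd_modM.
rewrite -sd_modM; congr sd_mod; elim: i => [|i IH]; first by rewrite expg0 mul1g.
by rewrite mulnS -addnA -rot_nat fa3 IH expgS mulgA.
Qed.

Let f_rotM q k :
  sd_mod (f (MkSD (M * q + k)%N%:R false)) = sd_mod (f (MkSD k%:R false)).
Proof.
elim: q => [|q IH]; first by rewrite muln0.
rewrite -{}IH mulnS -addnA -[in LHS]rot_nat.
have fM : mult_at f (MkSD M%:R false).
  have /dvdnP[m ->] : (3 %| M)%N by apply: dvdn_trans M6.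
  elim: m => [|m IH] y; first by rewrite mul0n mul1g (mult_at1 fa3) mul1g.
  by rewrite (mulSn m) -rot_nat -mulgA fa3 IH mulgA -fa3.
by rewrite fM sd_modM faM code_mul1.
Qed.

Lemma sd_mod_map x : sd_mod (f x) = F (sd_mod x).
Proof.
have rotE k : sd_mod (f (MkSD k%:R false)) =
    code_mul M (iter (k %% M %/ 3) (code_mul M A) (0%N, false))
        (nth (0%N, false) [:: (0%N, false); C; D] (k %% M %% 3)).
  rewrite {1}(divn_eq k M) (mulnC _ M) f_rotM.
  rewrite {1}(divn_eq (k %% M) 3) (mulnC _ 3) f_rot3; congr code_mul.
  have := ltn_pmod (k %% M) (isT : 0 < 3)%N.
  case: (_ %% 3)%N => [|[|[|?]]] //= _.
  by rewrite (_ : MkSD _ _ = 1%g) ?(mult_at1 fa3) ?sd_mod1.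
have [k ->] := SD_nat x; move: (sd_ref x) => {x} s.
rewrite sd_mod_nat /F /code_map /=.
rewrite code_twist_mod; case: s => /=; last exact: rotE.
have -> : MkSD k%:R true =
    (MkSD 0 true * MkSD ((2 * n - 1) * k)%N%:R false)%g :> SD n.
  rewrite -(sd_twist_nat true k); congr MkSD; rewrite /= add0r.
  exact: esym (sd_twistK true k%:R).
by rewrite fb sd_modM rotE -/B (twist_mod true).
Qed.

Lemma sd_mod_iter i x : sd_mod (iter i f x) = iter i F (sd_mod x).
Proof. by elim: i => //= i IH; rewrite sd_mod_map IH. Qed.

Lemma sd_mod_codes x : sd_mod x \in codes M.
Proof.
apply/allpairsP; exists (sd_ref x, (sd_exp x %% M)%N).
split=> //=; first by rewrite !inE; case: (sd_ref x).
by rewrite mem_iota ltn_pmod ?(ltnW M_gt1).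
Qed.

Lemma codes_sd_mod c : c \in codes M -> exists x, c = sd_mod x.
Proof.
case/allpairsP => -[s e] /= [_]; rewrite mem_iota => /= e_lt ->.
by exists (MkSD e%:R s); rewrite sd_mod_nat modn_small.
Qed.

(** The induced map is onto, since f is; hence injective on the codes. *)
Lemma code_map_uniq : uniq (map F (codes M)).
Proof.
have U : uniq (codes M).
  by apply: allpairs_uniq; rewrite ?iota_uniq // => -[? ?] [? ?] _ _ /= [-> ->].
apply: (leq_size_uniq U); last by rewrite size_map.
move=> _ /codes_sd_mod[x ->]; have [k _ kf] := injF_bij (so_inj S).
by rewrite -(kf x) sd_mod_map map_f // sd_mod_codes.
Qed.

Lemma code_map_comm k : code_comm M F (sd_mod (MkSD k%:R false)).
Proof.
apply/allP => _ /codes_sd_mod[y ->]; apply/eqP.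
by rewrite -!(sd_mod_map, sd_modV, sd_modM) (so_comm S).
Qed.

Section InX.
Variable x : SD n.
Hypothesis xX : x \in X.
Let O := traject F (sd_mod x) (2 * M).
Hypothesis O_closed : forall y, y \in O -> F y \in O.

Let memO y : y \in X -> sd_mod y \in O.
Proof.
case/(so_orbit S _ xX) => i ->; elim: i => [|i IH]; last first.
  by rewrite iterS sd_mod_map O_closed.
by apply/trajectP; exists 0%N => //; lia.
Qed.

Lemma traject_memX y : y \in O -> exists2 z, z \in X & y = sd_mod z.
Proof.
case/trajectP => i _ ->; exists (iter i f x); first exact: skew_orbit_iter S xX.
by rewrite sd_mod_iter.
Qed.

Lemma traject_inv : all (fun y => code_inv M y \in O) O.
Proof.
apply/allP => _ /traject_memX[z zX ->].
by rewrite -sd_modV memO // (so_inv S).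
Qed.

(** As X generates, its codes do not all lie in a proper subgroup Q. *)
Lemma traject_has (Q : pred (nat * bool)) g : Q (0%N, false) ->
    (forall y z, Q y -> Q z -> Q (code_mul M y z)) -> ~~ Q (sd_mod g) ->
  has (predC Q) O.
Proof.
move=> Q1 QM; apply: contraR => /hasPn nQ.
apply: (skew_orbit_closed S (P := fun y => Q (sd_mod y))).
- by rewrite sd_mod1.
- by move=> y z Qy Qz; rewrite sd_modM QM.
- by move=> y /memO /nQ; rewrite negbK.
Qed.

Lemma traject_spread : code_spread O.
Proof.
have mod1 : sd_mod (MkSD 1%:R false) = (1%N, false) by rewrite sd_mod_nat modn_small.
have par k : odd (k %% M) = odd k.
  by apply: odd_mod; case/dvdnP: M6 => m ->; rewrite oddM andbF.
have m3 k : (k %% M = k %[mod 3])%N.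
  by rewrite modn_dvdm //; apply: dvdn_trans M6.
apply/and4P; split.
- rewrite -(eq_has (a1 := predC (fun y : nat * bool => ~~ y.2))) => [|y];
    last by rewrite /= negbK.
  apply: (@traject_has _ (MkSD 0 true)) => // -[? s] [? s'] /=.
  by case: s s' => [] [].
- rewrite -(eq_has (a1 := predC (fun y : nat * bool => ~~ odd y.1))) => [|y];
    last by rewrite /= negbK.
  apply: (@traject_has _ (MkSD 1%:R false)) => [//|[e s] [e' s'] /=|];
    last by rewrite mod1.
  by rewrite par oddD; case: s => /=; rewrite ?oddM; do 2![case: (odd _)].
- rewrite -(eq_has (a1 := predC (fun y : nat * bool => ~~ (odd y.1 (+) y.2)))) => [|y];
    last by rewrite /= negbK.
  apply: (@traject_has _ (MkSD 1%:R false)) => [//|[e s] [e' s'] /=|];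
    last by rewrite mod1.
  by rewrite par oddD; case: s s' => [] [] /=; rewrite ?oddM; do 2![case: (odd _)].
apply/allP => j _.
rewrite -(eq_has (a1 := predC (fun y : nat * bool =>
  (y.1 + y.2 * j) %% 3 == 0)%N)) => [|y] //.
apply: (@traject_has _ (MkSD 1%:R false)) => [//|[e s] [e' s'] /=|];
  last by rewrite mod1.
move=> H H'; rewrite -modnDml m3 modnDml.
by move: H H'; case: s s' => [] [] /=; lia.
Qed.

End InX.

(** Every test of [code_search] holds for the values at a^3, b, a and a^2 of the
map F induced on codes, so the conclusion of a successful search holds for
the image O of X. *)
Lemma code_searchP post LA LB x : code_search M post LA LB ->
  A \in LA -> B \in LB -> code_mul M A B = code_mul M B A -> x \in X ->
  exists F0 O, [/\ forall y, sd_mod (f y) = F0 (sd_mod y),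
    {in O, forall y, exists2 z, z \in X & y = sd_mod z} & post F0 O].
Proof.
move=> search LAA LBB AB xX; exists F, (traject F (sd_mod x) (2 * M)).
split; [exact: sd_mod_map | exact: traject_memX |].
move: search LAA LBB AB xX => /allP/(_ A) search LAA LBB AB xX.
move/allP/(_ B LBB): (search LAA).
have -> : code_mul M B B = (0%N, false).
  rewrite /B -sd_modM -fb.
  have -> : (MkSD 0 true * MkSD 0 true)%g = 1%g :> SD n.
    by congr MkSD; rewrite /= mulr0 addr0.
  by rewrite (mult_at1 fa3) sd_mod1.
rewrite AB !eqxx /= => /allP/(_ C (sd_mod_codes _)).
have -> : code_inj M (code_map M A B C C) 2.
  have -> : code_inj M (code_map M A B C C) 2 = code_inj M F 2.
    congr uniq; apply/eq_in_map => -[e s]; rewrite mem_filter => /andP[+ _].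
    rewrite /F /code_map /=.
    have -> : (code_twist s e %% M %% 3 = code_twist s e %% 3)%N.
      by rewrite modn_dvdm //; apply: dvdn_trans M6.
    by case: (_ %% 3)%N => [|[|?]].
  by apply: subseq_uniq code_map_uniq; rewrite map_subseq // filter_subseq.
move=> /allP/(_ D (sd_mod_codes _)); rewrite /code_check -/F code_map_uniq.
have [-> ->] : code_comm M F (1%N, false) /\ code_comm M F (2%N, false).
  have M2 : (2 < M)%N by have := dvdn_leq (ltnW M_gt1) M6; lia.
  have := (code_map_comm 1, code_map_comm 2).
  by rewrite !sd_mod_nat !modn_small // => -[].
move=> /allP/(_ (sd_mod x) (sd_mod_codes _))/andP[/allP O_closed].
by rewrite traject_inv // traject_spread.
Qed.

End Reduction.

(** * The case where f (a^3) is a rotation *)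

Section Cases.

Variable n : nat.
Hypotheses (n_gt1 : (1 < n)%N) (n3 : (3 %| n)%N).
Local Notation R := 'Z_(4 * n).
Local Notation h := ((2 * n)%:R : R).
Local Notation mu := ((n %/ 3)%:R : R).
Local Notation rot u := (MkSD (n := n) u%R false).
Local Notation rfl u := (MkSD (n := n) u%R true).

Lemma SD_mulh_eq0 (x : R) : h * x = 0 -> exists y, x = 2 * y.
Proof.
clear n3; rewrite -[x]natr_Zp; move: (nat_of_ord x) => k; rewrite -(odd_double_half k).
case: (odd k) => hk; last first.
  by exists (k./2)%:R; rewrite add0n -mul2n (natrM _ 2).
have /eqP[] := SD_h_neq0 n_gt1.
by rewrite -[LHS](SD_hodd (k./2)%:R) -hk natrD -mul2n (natrM _ 2 k./2).
Qed.

Lemma SD_mulh_id (x : R) : h * x = h -> exists y, x = 1 + 2 * y.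
Proof.
move=> hx; have [y E] : exists y, x - 1 = 2 * y.
  by apply: SD_mulh_eq0; rewrite mulrBr hx mulr1 subrr.
by exists y; rewrite -E addrC subrK.
Qed.

Lemma SD_mul2_eq0 (x : R) : 2 * x = 0 -> x = 0 \/ x = h.
Proof.
clear n3; rewrite -[x]natr_Zp -[2]/(2%:R) -natrM; have := ltn_ord x.
rewrite [X in (_ < X)%N]Zp_cast; last lia.
move: (nat_of_ord x) => k k_lt /(congr1 val) /=.
rewrite val_Zp_nat; last lia.
move=> /eqP k2; have [->|->] : k = 0%N \/ k = (2 * n)%N.
- case/dvdnP: k2 => -[|[|q]]; [left | right |]; nia.
- by left.
- by right.
Qed.

Let d6 : (6 %| 4 * n)%N.
Proof. by move: n3 => /dvdnP[k ->]; apply/dvdnP; exists (2 * k)%N; lia. Qed.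

Lemma mod6_eq (x : R) c : (x %% 6 = c)%N -> exists i, x = c%:R + 6 * i.
Proof.
move=> <-; exists (x %/ 6)%:R; rewrite -[6]/(6%:R) -natrM -natrD.
by rewrite (addnC (x %% 6)%N) (mulnC 6) -divn_eq natr_Zp.
Qed.

Lemma sd_mod6_eq c (i : R) s : sd_mod 6 (MkSD (c%:R + 6 * i) s) = ((c %% 6)%N, s).
Proof.
have -> : c%:R + 6 * i = (c + 6 * i)%N%:R :> R by rewrite natrD natrM natr_Zp.
by rewrite sd_mod_nat // -modnDmr modnMr addn0.
Qed.

(** The automorphism inverting a exchanges the two orientations. *)
Lemma sd_mod6_opp (g : SD n) c s : (c <= 6)%N -> sd_mod 6 g = (c, s) ->
  sd_mod 6 (sd_aff (-1) 0 g) = (((6 - c) %% 6)%N, s).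
Proof.
case: g => i s' c6 [/mod6_eq[j ->] ->]; rewrite -(sd_mod6_eq _ (- 1 - j)).
congr (sd_mod 6 (MkSD _ _)); rewrite /= if_same natrB //; ring.
Qed.

Section Rotational.

Variables (f : SD n -> SD n) (X : {set SD n}) (r rho B : R) (x : SD n).
Hypotheses (S : skew_orbit f X) (rE : r = 1 + 2 * rho).
Hypotheses (fN : forall i, mult_at f (rot (3 * i)))
  (fNE : forall i, f (rot (3 * i)) = rot (3 * r * i)).
Hypotheses (fb : mult_at f (rfl 0)) (fbE : f (rfl 0) = rfl B) (xX : x \in X).
Local Notation rho6 := (@sd_mod n 6).

Lemma octahedral_case : rho6 x = (1%N, false) -> rho6 (f x) = (5%N, false) ->
  rho6 (f (f x)) \in [:: (0%N, true); (3%N, true)] -> in_family f X.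
Proof.
move Ex: x => x'; case: x' Ex => i s Ex [/mod6_eq[i0 iE] sE].
subst s; case Ey: (f (rot i)) => [j s] [/mod6_eq[i1 jE] sE]; subst s.
case Ez: (f (rot j)) => [k s]; rewrite !inE => /orP kE.
have {kE} [[g kE] sE] : (exists g, k = 3 * g) /\ s = true.
  split; last by case: kE => /eqP[_ ->].
  case: kE => /eqP[] /mod6_eq[g ->] _; first by exists (2 * g); ring.
  by exists (1 + 2 * g); ring.
subst s; pose e1 := - j; have jE' : j = - e1 by rewrite opprK.
have e1E : e1 = 1 + 6 * (- 1 - i1) by rewrite /e1 jE; ring.
have fN' u y : f (rot (3 * u) * y)%g = (rot (3 * r * u) * f y)%g.
  by rewrite fN fNE.
have fi : f (rot i) = rot (- e1) by rewrite Ey jE'.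
have fj : f (rot (- e1)) = rfl (3 * g) by rewrite -jE' Ez kE.
have iX : rot i \in X by rewrite -Ex.
exact: (octahedral_in_family n_gt1 n3 erefl (SD_h6 n_gt1 n3)
          S rE iE e1E fN' fb fbE iX fi fj).
Qed.

End Rotational.

Section KernelImages.

Variables (f : SD n -> SD n) (X : {set SD n}).
Hypothesis S : skew_orbit f X.
Hypotheses (fa : mult_at f (rot 3%:R)) (fb : mult_at f (rfl 0)).

Let f1 : f 1%g = 1%g := mult_at1 fa.
Let rot0 : rot 0 = 1%g := erefl.

Let rotn (i : R) : rot (3 * i) = (rot 3%:R ^+ i)%g.
Proof.
rewrite -[in LHS](natr_Zp i); elim: (nat_of_ord i) => [|k IH].
  by rewrite mulr0 expg0.
by rewrite expgS -IH -[k.+1%:R]natr1 mulrDr mulr1 addrC.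
Qed.

Lemma mult_atX k : mult_at f (rot 3%:R ^+ k)%g /\
  f (rot 3%:R ^+ k)%g = (f (rot 3%:R) ^+ k)%g.
Proof.
have L : mult_at f (rot 3%:R ^+ k)%g.
  elim: k => [|k IH] y; first by rewrite expg0 !mul1g f1 mul1g.
  by rewrite expgS -mulgA fa IH mulgA -fa.
split=> //; elim: k {L} => [|k IH]; first by rewrite !expg0.
by rewrite !expgS fa IH.
Qed.

(** The order 4n/3 of a^3 forces w to be a multiple of 3.  The multiplier r is
odd because f fixes the involution a^(2n) of <a^3>. *)
Lemma rotational_image w : f (rot 3%:R) = rot w ->
  exists r rho : R, [/\ r = 1 + 2 * rho,
    forall i, mult_at f (rot (3 * i)) &
    forall i, f (rot (3 * i)) = rot (3 * r * i)].
Proof.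
move=> fw; have rotX (x : R) k : (rot x ^+ k)%g = rot (x * k%:R).
  elim: k => [|k IH]; first by rewrite mulr0 expg0.
  by rewrite expgS IH -[k.+1%:R]natr1 mulrDr mulr1 addrC.
have [r wr] : exists r, w = 3 * r.
  have [_] := mult_atX (4 * (n %/ 3)); rewrite fw !rotX.
  have -> : 3%:R * (4 * (n %/ 3))%:R = 0 :> R.
    by rewrite -natrM mulnCA (mulnC 3) divnK // SD_4n0.
  rewrite rot0 f1 -[w]natr_Zp -natrM => /MkSD_inj[/(congr1 val) /= + _].
  rewrite val_Zp_nat; last by clear n3; lia.
  move: (nat_of_ord w) n3 => k /dvdnP[m nm] /esym/eqP/dvdnP[q].
  rewrite nm mulnK // => E; exists (k %/ 3)%:R.
  rewrite -[3]/(3%:R) -natrM (mulnC 3) divnK //; apply/dvdnP; exists q.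
  have m_gt0 : (0 < m)%N by lia.
  by apply/eqP; rewrite -(eqn_pmul2r (m := 4 * m)) ?muln_gt0 // E; apply/eqP; nia.
have fNE i : f (rot (3 * i)) = rot (3 * r * i).
  by rewrite rotn; have [_ ->] := mult_atX i; rewrite fw rotX natr_Zp wr.
have hr : h * r = h.
  have [] := SD_parity r => // hr; have := fNE (2 * mu).
  have hmu : 6 * mu = h := esym (SD_h6 n_gt1 n3).
  have -> : 3 * (2 * mu) = h by rewrite -hmu; ring.
  have -> : 3 * r * (2 * mu) = 0 by rewrite -hr -hmu; ring.
  rewrite rot0 -f1 => /(so_inj S) /MkSD_inj[/eqP].
  by rewrite (negPf (SD_h_neq0 n_gt1)).
have [rho rE] := SD_mulh_id hr; exists r, rho; split=> // i.
by rewrite rotn; have [] := mult_atX i.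
Qed.

(** f b is an involution other than a^(2n), which f fixes. *)
Lemma reflection_image w : f (rot 3%:R) = rot w ->
  exists2 B, f (rfl 0) = rfl B & h * B = 0.
Proof.
move=> /rotational_image[r [rho [rE fN fNE]]].
have bb : (rfl 0 * rfl 0)%g = 1%g by congr MkSD; rewrite /= mulr0 addr0.
have := fb (rfl 0); rewrite bb f1; case E: (f (rfl 0)) => [z []] /esym/MkSD_inj[/= zz _].
  exists z => //; rewrite -zz; ring.
have hmu : 6 * mu = h := esym (SD_h6 n_gt1 n3).
have fh : f (rot h) = rot h.
  have -> : h = 3 * (2 * mu) by rewrite -hmu; ring.
  rewrite fNE; congr MkSD; rewrite rE.
  apply: (@eq_subr_comb _ (2 * (6 * mu) * rho)); first by ring.
  by rewrite hmu SD_h2 mul0r.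
have [z0|zh] : z = 0 \/ z = h by apply: SD_mul2_eq0; rewrite -zz; ring.
  by move: E; rewrite z0 rot0 -f1 => /(so_inj S) [].
by move: E; rewrite zh -fh => /(so_inj S) [].
Qed.

Lemma rotational_case w : f (rot 3%:R) = rot w -> in_family f X.
Proof.
move=> fw; have [r [rho [rE fN fNE]]] := rotational_image fw.
have [B fbE hB] := reflection_image fw.
have [x xX] := skew_orbit_exists S.
have m2n : (2 * n = 6 %[mod 6])%N.
  by case/dvdnP: n3 => k ->; clear; lia.
have f6 : sd_mod 6 (f (MkSD 6%:R false)) = (0%N, false).
  have -> : MkSD 6%:R false = rot (3 * 2%:R) by congr MkSD; ring.
  rewrite fNE; have -> : 3 * r * 2%:R = (6 * r)%N%:R :> R.
    by rewrite natrM natr_Zp; ring.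
  by rewrite sd_mod_nat // modnMr.
have A3 : sd_mod 6 (f (rot 3%:R)) = (3%N, false).
  have -> : rot 3%:R = rot (3 * 1) by rewrite mulr1.
  rewrite fNE rE; have -> : 3 * (1 + 2 * rho) * 1 = (3 + 6 * rho)%N%:R :> R.
    by rewrite natrD natrM natr_Zp; ring.
  by rewrite sd_mod_nat // -modnDmr modnMr.
have BB : sd_mod 6 (f (rfl 0)) \in [:: (0%N, true); (2%N, true); (4%N, true)].
  have [b bE] := SD_mulh_eq0 hB; rewrite fbE bE.
  have -> : 2 * b = (2 * b)%N%:R :> R by rewrite natrM natr_Zp.
  rewrite sd_mod_nat // !inE !xpair_eqE !andbT; lia.
have [||F [O [fF OX /hasP[y /OX[z zX ->]]]]] :=
    code_searchP (M := 6) n_gt1 isT isT d6 m2n S fa fb f6 search_mod6 _ BB _ xX.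
- by rewrite A3.
- by rewrite A3; move: BB; rewrite !inE => /orP[|/orP[]] /eqP ->.
rewrite -!fF => /andP[ffz /orP[] /andP[/eqP zE /eqP fzE]].
  exact: (octahedral_case S rE fN fNE fb fbE zX zE fzE ffz).
(* The class of z is a^-1: conjugate by the automorphism inverting a. *)
have m1U : (-1 : R) \is a GRing.unit by rewrite unitrN1.
have h0 : h * 0 = 0 by rewrite mulr0.
pose d := @sd_aff n (-1) 0.
have dK : cancel d _ := sd_affK 0 m1U; have d'K : cancel _ d := sd_affVK 0 m1U.
have dM := sd_affM (-1) h0.
have dN i : rot (3 * i) = d (rot (3 * (- i))).
  by congr MkSD; rewrite /=; ring.
have db : rfl 0 = d (rfl 0) by congr MkSD; rewrite /=; ring.
have [fz_6 ffz_6] : sd_mod 6 (f z) = (1%N, false) /\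
    sd_mod 6 (f (f z)) \in [:: (0%N, true); (3%N, true)] by [].
apply: (in_family_conj m1U h0).
apply: (octahedral_case (B := - B) (x := d z) (skew_orbit_conj dK d'K dM S) rE).
- by move=> i; rewrite dN; apply: mult_at_conj.
- by move=> i; rewrite dN /= dK fNE; congr MkSD; rewrite /=; ring.
- by rewrite db; apply: mult_at_conj.
- by rewrite db /= dK fbE; congr MkSD; rewrite /=; ring.
- exact: imset_f.
- by rewrite (sd_mod6_opp _ zE).
- by rewrite /= dK (sd_mod6_opp _ fz_6).
rewrite /= !dK; move: ffz_6; case E: (sd_mod 6 (f (f z))) => [c s].
rewrite !inE => /orP[] /eqP[cE sE]; rewrite (sd_mod6_opp _ E) ?cE ?sE //.
Qed.

End KernelImages.

End Cases.

(** * The case where f (a^3) is a reflection *)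

Lemma sd_mod12_inj : injective (@sd_mod 3 12).
Proof.
move=> [i s] [j s'] [+ ->]; rewrite !modn_small ?(ltn_ord i) ?(ltn_ord j) //.
by move/val_inj => ->.
Qed.

Lemma sd_mod12_aff u v (g : SD 3) :
  sd_mod 12 (sd_aff u%:R v%:R g) = code_aff u v (sd_mod 12 g).
Proof.
case: g => i s; rewrite -[i]natr_Zp; move: (nat_of_ord i) => k.
have -> : sd_aff u%:R v%:R (MkSD k%:R s) = MkSD (u * k + s * v)%N%:R s :> SD 3.
  by congr MkSD; rewrite natrD !natrM; case: s; rewrite /= ?mul1r ?mul0r.
rewrite !sd_mod_nat // /code_aff /=; congr (_, _).
by rewrite -[RHS]modnDml modnMmr modnDml.
Qed.

Lemma family_a_seq_mod : map (@sd_mod 3 12) (family_a_seq 3) = code_family_a.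
Proof. by vm_compute. Qed.

Lemma SD24_case (f : SD 3 -> SD 3) (X : {set SD 3}) w :
    skew_orbit f X ->
    mult_at f (MkSD 3%:R false) -> mult_at f (MkSD 0 true) ->
    f (MkSD 3%:R false) = MkSD w true ->
  in_family f X.
Proof.
move=> S fa fb fw.
have [x xX] : exists x, x \in X by exact: skew_orbit_exists S.
have f12 : sd_mod 12 (f (MkSD 12%:R false)) = (0%N, false).
  have -> : MkSD 12%:R false = 1%g :> SD 3 by congr MkSD; apply/val_inj.
  by rewrite (mult_at1 fa).
have [|||F [O [fF OX /hasP[y /OX[z zX ->]]]]] :=
   code_searchP (n := 3) (M := 12) isT isT isT isT erefl S fa fb f12
     search_mod12 _ _ _ xX.
- rewrite fw; apply/mapP; exists (w %% 12)%N => //.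
  by rewrite mem_iota ltn_pmod.
- exact: sd_mod_codes.
- rewrite -!sd_modM // -fa -fb; congr (sd_mod 12 (f _)).
  by congr MkSD; apply/val_inj.
case/hasP=> u u_in /hasP[v v_in /andP[/eqP F12 /eqP Fu]].
have iterF i : sd_mod 12 (iter i f z) = iter i F (sd_mod 12 z).
  by elim: i => //= i IH; rewrite fF IH.
exists u%:R, v%:R, z; split=> //.
- by rewrite unitZpE //; move: u_in; rewrite !inE => /or4P[] /eqP->.
- by apply/val_inj; move: v_in; rewrite !inE => /or4P[|||/or3P[]] /eqP->.
left; split=> // i; apply: sd_mod12_inj; rewrite sd_mod12_aff iterF.
rewrite {1}(divn_eq i 12) addnC iterD.
rewrite (_ : iter (_ * _) F _ = sd_mod 12 z); last first.
  by elim: (i %/ 12)%N => [|k IH] //; rewrite mulSn iterD IH.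
rewrite -(nth_map 1%g (0%N, false) (sd_mod 12)); last by rewrite ltn_pmod.
rewrite family_a_seq_mod -Fu.
rewrite (nth_map (sd_mod 12 z) (0%N, false)) ?size_traject ?ltn_pmod //.
by rewrite nth_traject ?ltn_pmod.
Qed.

(** The image of a^3 under a map multiplicative at a^3 has the order of a^3; the
fourth power of a reflection is 1, so in the second case a^12 = 1. *)
Lemma skew_orbit_in_family n (f : SD n -> SD n) (X : {set SD n}) :
    (1 < n)%N -> (3 %| n)%N -> skew_orbit f X ->
    mult_at f (MkSD 3%:R false) -> mult_at f (MkSD 0 true) ->
  in_family f X.
Proof.
move=> n_gt1 n3 S fa fb; case fw: (f (MkSD 3%:R false)) => [w []]; last first.
  exact: (rotational_case n_gt1 n3 S fa fb fw).
suff n3E : n = 3 by subst n; apply: SD24_case S fa fb fw.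
have f12 : f (MkSD 12%:R false) = 1%g.
  have -> : MkSD 12%:R false = (MkSD 3%:R false ^+ 4)%g :> SD n.
    by rewrite !expgS expg0 mulg1; congr MkSD; rewrite /= -!natrD.
  have [_ ->] := mult_atX fa 4; rewrite fw !expgS expg0 mulg1 mulgA.
  have -> : (MkSD w true * MkSD w true)%g = MkSD ((2 * n)%:R * w) false :> SD n.
    by congr MkSD; rewrite /=; ring.
  by congr MkSD; rewrite /= -mulrDl -natrD addnn -mul2n mulnA SD_4n0 mul0r.
have : MkSD 12%:R false = 1%g :> SD n.
  by apply: (so_inj S); rewrite f12 (mult_at1 fa).
case/MkSD_inj => + _; move/(congr1 (@nat_of_ord _)).
rewrite val_Zp_nat; last lia.
move=> /eqP/dvdnP[q]; case/dvdnP: n3 => m nm E.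
have /eqP : (q * m = 1)%N by rewrite nm in E; lia.
by rewrite muln_eq1 => /andP[_ /eqP m1]; rewrite nm m1.
Qed.

(** * Subgroups of index three *)

Section Kernel.

Variable n : nat.
Hypothesis n_gt1 : (1 < n)%N.
Local Notation R := 'Z_(4 * n).

Lemma card_SD : #|{: SD n}| = (8 * n)%N.
Proof.
have /bij_eq_card -> : bijective (@SD_pair n).
  by exists (@pair_SD n); [apply: SD_pairK | case].
rewrite card_prod card_ord card_bool Zp_cast; lia.
Qed.

Lemma order_sda : #[sda n]%g = (4 * n)%N.
Proof.
apply/eqP; rewrite eqn_dvd order_dvdn sdaX SD_4n0 eqxx /=.
have := expg_order (sda n); rewrite sdaX => /MkSD_inj[+ _].
move/(congr1 (@nat_of_ord _)); rewrite val_Zp_nat; last lia.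
by move/eqP.
Qed.

(** Counting gives |<a> H| <= 8n and so |<a> :&: H| >= 4n/3, while this order
divides both 4n and 8n/3; hence <a> :&: H = <a^3>, and H contains a
reflection.  If that one has an odd exponent, its product with a^3 has an
even one. *)
Lemma index3_SD (H : {group SD n}) : #|[set: SD n] : H|%g = 3 ->
  [/\ (3 %| n)%N, MkSD 3%:R false \in H &
     exists2 v, (2 * n)%:R * v = 0 & MkSD v true \in H].
Proof.
move=> H3; have := Lagrange (subsetT H); rewrite H3 cardsT card_SD => cH.
have n3 : (3 %| n)%N.
  by rewrite -(Gauss_dvdr (m := 3) (n := 8)) // -cH dvdn_mull.
have [m nm] : exists m, n = (m * 3)%N by apply/dvdnP.
have {}cH : #|H| = (8 * m)%N by lia.
have m_gt0 : (0 < m)%N by lia.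
have ca : #|<[sda n]>%g| = (12 * m)%N by rewrite -orderE order_sda; lia.
have cI : #|<[sda n]> :&: H|%g = (4 * m)%N.
  have := mul_cardG <[sda n]>%G H; rewrite ca cH => E.
  have AHle : (#|<[sda n]> * H|%g <= 8 * n)%N by rewrite -card_SD max_card.
  have d1 : (#|<[sda n]> :&: H|%g %| 12 * m)%N by rewrite -ca cardSg ?subsetIl.
  have d2 : (#|<[sda n]> :&: H|%g %| 8 * m)%N by rewrite -cH cardSg ?subsetIr.
  apply/eqP; rewrite eqn_leq; apply/andP; split.
    apply: dvdn_leq; first by lia.
    have -> : (4 * m = 12 * m - 8 * m)%N by lia.
    exact: dvdn_sub.
  move: (#|<[sda n]> :&: H|%g) (#|<[sda n]> * H|%g) E AHle => k l E le_l.
  have := leq_mul le_l (leqnn k); rewrite -E nm => {}E.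
  by rewrite -(leq_pmul2l (m := 24 * m)) ?muln_gt0 //; lia.
have a3H : MkSD 3%:R false \in H.
  have : <[sda n ^+ 3]>%g == (<[sda n]> :&: H)%g :> {set SD n}.
    rewrite (eq_subG_cyclic (cycle_cyclic (sda n))) ?cycleX ?subsetIl //.
    by rewrite cI -orderE orderXdiv order_sda; [lia | rewrite dvdn_mull].
  move/eqP/setP/(_ (sda n ^+ 3)%g); rewrite cycle_id inE => /esym/andP[_].
  by rewrite sdaX.
split=> //; have /subsetPn[[v s] gH ga] : ~~ (H \subset <[sda n]>%g).
  by apply/negP => /setIidPr HI; move: cI; rewrite HI cH; lia.
case: s gH ga => gH ga; last first.
  by case/cycleP: ga; exists v; rewrite sdaX natr_Zp.
have [hv|hv] := SD_parity v; first by exists v.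
exists (3%:R + v); first last.
  have -> : MkSD (3%:R + v) true = (MkSD 3%:R false * MkSD v true)%g by [].
  exact: groupM.
apply: (@eq_subr_comb _ (((2 * n)%:R * v - (2 * n)%:R) + 2 * (2 * n)%:R * 2)).
  by move: ((2 * n)%:R) => hh; ring.
by rewrite hv SD_h2; ring.
Qed.

End Kernel.

(** * Isomorphisms of Cayley maps *)

Lemma next_nth_mod (T : eqType) (s : seq T) x0 i : uniq s -> (0 < size s)%N ->
  next s (nth x0 s (i %% size s)) = nth x0 s (i.+1 %% size s).
Proof.
move=> Us s0; rewrite -[i.+1]addn1 -modnDml addn1.
have := ltn_pmod i s0; move: (i %% size s)%N => {}i lti.
rewrite next_nth mem_nth // index_uniq //.
case: s Us s0 lti => // y s Us _; rewrite /= ltnS leq_eqVlt => /predU1P[-> | lti].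
  by rewrite modnn nth_default.
by rewrite modn_small ?ltnS //=; apply: set_nth_default.
Qed.

Section CycleIso.

Variables (gT hT : finGroupType) (d : gT -> hT) (d' : hT -> gT).
Hypotheses (dK : cancel d d') (d'K : cancel d' d).
Hypothesis dM : {morph d : x y / (x * y)%g}.

Lemma cm_iso_cycle (M : cayley_data gT) (f : gT -> gT) (s : seq hT) x :
    {in cm_set M, f =1 cm_rot M} -> x \in cm_set M ->
    (forall y, y \in cm_set M <-> exists i, y = iter i f x) ->
    uniq s -> (0 < size s)%N ->
    (forall i, d (iter i f x) = nth 1%g s (i %% size s)) ->
  cm_iso M (CM [set:: s] (cycle_perm s)).
Proof.
move=> fp xX orb Us s0 dE.
have dM' : {in [set: gT] &, {morph d : x y / (x * y)%g}}.
  by move=> y z _ _; apply: dM.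
exists (Morphism dM'); split.
- apply/isomP; split.
    by apply/injmP => y z _ _ /(can_inj dK).
  apply/setP => y; rewrite inE morphimEdom /=; apply/imsetP.
  by exists (d' y); rewrite ?inE ?d'K.
- apply/setP => y; rewrite inE /=; apply/imsetP/idP.
    by case=> z /orb[i ->] ->; rewrite dE mem_nth ?ltn_pmod.
  move=> ys; exists (iter (index y s) f x); first by apply/orb; exists (index y s).
  by rewrite dE modn_small ?index_mem ?nth_index.
move=> y yX /=; rewrite -(fp _ yX); have [i ->] := (orb y).1 yX.
by rewrite -iterS !dE cycle_permE // next_nth_mod.
Qed.

End CycleIso.

Lemma skew_morphism_orbit (gT : finGroupType) (M : cayley_data gT)
    (phi : skew_morphism gT) :
  is_cayley_map M -> {in cm_set M, phi =1 cm_rot M} ->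
  skew_orbit phi (cm_set M).
Proof.
case/and5P=> _ /forall_inP XV /eqP genX pX /forall_inP orbX phiE; split=> //.
- exact: perm_inj.
- move=> g h; have E y :
    ((phi g)^-1 * phi (g * y) = (skew_perm phi ^+ skew_pow phi g) y)%g.
    by rewrite skewM mulKg.
  by rewrite !E -!permM -expgS -expgSr.
move=> x y xX; rewrite -(eqP (orbX x xX)).
have E i : iter i phi x = (cm_rot M ^+ i)%g x.
  elim: i => [|i IH]; first by rewrite expg0 perm1.
  rewrite expgSr permM -IH /= phiE // IH -(eqP (orbX x xX)).
  by apply/porbitP; exists i.
split=> [/porbitP[i ->]|[i ->]]; first by exists i.
by rewrite E; apply/porbitP; exists i.
Qed.

Section FamilyBIso.

Variables (n : nat) (t : {unit 'Z_(4 * n)}).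
Hypotheses (n_gt1 : (1 < n)%N) (odd_t : odd #[t]%g).
Local Notation k := #[t]%g.

Lemma family_b_elt_mod i : family_b_elt t (i %% (4 * k)) = family_b_elt t i.
Proof.
have -> : family_b_elt t i =
    family_b_elt t (i %% (4 * k) + 4 * k * (i %/ (4 * k))).
  by rewrite addnC mulnC -divn_eq.
rewrite [RHS]family_b_eltE [LHS]family_b_eltE -mulnA.
rewrite -[in RHS]modnDmr modnMr addn0.
have -> // : FinRing.uval t ^+ (i %% (4 * k) + 4 * (k * (i %/ (4 * k)))) =
   FinRing.uval t ^+ (i %% (4 * k)).
by apply/eqP; rewrite family_b_eqX // mulnCA -modnDmr modnMr addn0.
Qed.

Lemma family_b_rot i :
  cm_rot (family_b t) (family_b_elt t i) = family_b_elt t i.+1.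
Proof.
have s0 : (0 < size (mkseq (family_b_elt t) (4 * k)))%N.
  by rewrite size_mkseq muln_gt0 order_gt0.
have nthE j : family_b_elt t j =
    nth 1%g (mkseq (family_b_elt t) (4 * k))
      (j %% size (mkseq (family_b_elt t) (4 * k))).
  rewrite size_mkseq nth_mkseq ?family_b_elt_mod // ltn_pmod //.
  by rewrite muln_gt0 order_gt0.
rewrite !nthE /= cycle_permE ?family_b_uniq //.
by rewrite next_nth_mod ?family_b_uniq.
Qed.

Lemma family_b_mem_elt i : family_b_elt t i \in cm_set (family_b t).
Proof.
rewrite inE -family_b_elt_mod map_f // mem_iota /= ltn_pmod //.
by rewrite muln_gt0 order_gt0.
Qed.

Lemma family_b_setP x :
  x \in cm_set (family_b t) -> exists i, x = family_b_elt t i.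
Proof. by rewrite inE => /mapP[i _ ->]; exists i. Qed.

Lemma family_b_sq i :
  (family_b_elt t i * family_b_elt t i == 1)%g = (1 < i %% 4)%N.
Proof.
have uP := family_b_2n n_gt1 odd_t i.
have neq1 j : (FinRing.uval t ^+ j + FinRing.uval t ^+ j == 0) = false.
  by rewrite addr_eq0 (negPf (family_b_neqN n_gt1 odd_t _ _)).
have invol e : (2 * n)%:R * e = 0 -> (MkSD e true * MkSD e true)%g = 1%g :> SD n.
  by move=> he; rewrite -{2}(family_b_invol he) mulgV.
rewrite family_b_eltE //; have := ltn_pmod i (isT : 0 < 4)%N.
case: (i %% 4)%N => [|[|[|[|m]]]] //= _; apply/eqP.
- by move/MkSD_inj=> [/eqP]; rewrite /= neq1.
- by move/MkSD_inj=> [/eqP]; rewrite /= -opprD oppr_eq0 neq1.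
- apply: invol; apply: (@eq_subr_comb _ (((2 * n)%:R * FinRing.uval t ^+ i
    - (2 * n)%:R) + 2 * (2 * n)%:R * 2)).
    by move: ((2 * n)%:R) => h; ring.
  by rewrite uP SD_h2; ring.
apply: invol; rewrite (natrD _ 3 (2 * n)).
apply: (@eq_subr_comb _ (- ((2 * n)%:R * FinRing.uval t ^+ i
    - (2 * n)%:R) + 2 * (2 * n)%:R + (2 * n)%:R * (2 * n)%:R)).
  by move: ((2 * n)%:R) => h; ring.
by rewrite uP SD_h2 SD_hh; ring.
Qed.

End FamilyBIso.

(** The set and the cycle of the first family list the same elements in
different orders. *)
Lemma family_aE :
  family_a = CM [set:: family_a_seq 3] (cycle_perm (family_a_seq 3)).
Proof.
have E (s : seq (SD 3)) : size s = 12%N ->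
    [set:: [seq nth 1%g s i |
      i <- [:: 10; 0; 2; 4; 6; 8; 1; 3; 5; 7; 9; 11]%N]] = [set:: s].
  move=> s12; apply/setP => y.
  rewrite !in_set -[s in RHS](mkseq_nth 1%g) s12.
  by apply: perm_mem; apply: perm_map.
by rewrite -(E (family_a_seq 3)).
Qed.

Lemma in_set_all (T : finType) (P : pred T) (s : seq T) x :
  all P s -> x \in [set:: s] -> P x.
Proof. by move=> /allP sP; rewrite inE => /sP. Qed.

Lemma family_a_sq x : x \in cm_set family_a -> (x * x)%g != 1%g.
Proof.
rewrite family_aE; apply: (in_set_all (P := fun x => (x * x)%g != 1%g)).
by vm_compute.
Qed.

Lemma cm_iso_family_a_b n (t : {unit 'Z_(4 * n)}) :
  (1 < n)%N -> odd #[t]%g -> ~ cm_iso family_a (family_b t).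
Proof.
move=> n_gt1 odd_t [d [/isomP[/injmP d_inj _] dX _]].
have := family_b_mem_elt t 2; rewrite -dX => /imsetP[x xX Ex].
have /negP[] := family_a_sq xX; apply/eqP/d_inj; rewrite ?inE //.
by rewrite morph1 morphM ?inE // -Ex; apply/eqP; rewrite family_b_sq.
Qed.

(** Involutions sit at the positions 2 and 3 modulo 4 of either cycle, so the
entry a at position 0 goes to some a^u, with u a unit, at a position divisible
by 4; the image of the next entry is then both a^-(u t) and a^-(u t'). *)
Lemma cm_iso_family_b n (t t' : {unit 'Z_(4 * n)}) : (1 < n)%N ->
  odd #[t]%g -> odd #[t']%g -> cm_iso (family_b t) (family_b t') -> t = t'.
Proof.
move=> n_gt1 odd_t odd_t' [d [/isomP[/injmP d_inj _] dX dR]].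
have mem := family_b_mem_elt t.
have [c Ec] : exists c, d (family_b_elt t 0) = family_b_elt t' c.
  by apply: family_b_setP; rewrite -dX; apply: imset_f; apply: mem.
have dE i : d (family_b_elt t i) = family_b_elt t' (c + i).
  elim: i => [|i IH]; first by rewrite addn0.
  by rewrite -family_b_rot // -dR ?mem // IH family_b_rot // addnS.
have dsq i : (1 < (c + i) %% 4)%N = (1 < i %% 4)%N.
  rewrite -[RHS](family_b_sq n_gt1 odd_t) -[LHS](family_b_sq n_gt1 odd_t').
  rewrite -dE -morphM ?inE //; apply/eqP/eqP => [E|->]; last by rewrite morph1.
  by apply: d_inj; rewrite ?inE ?morph1.
have c4 : (c %% 4 = 0)%N by move: (dsq 0%N) (dsq 1%N) (dsq 2%N); clear; lia.
pose u := FinRing.uval t; pose u' := FinRing.uval t'.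
have da : d (sda n) = MkSD (u' ^+ c) false.
  have := dE 0%N; rewrite !family_b_eltE //= addn0 c4 => <-.
  by congr (d _); congr MkSD; rewrite expr0.
have := dE 1%N; rewrite !family_b_eltE //= -modnDml c4 /=.
have -> : MkSD (- u ^+ 1) false = (sda n ^- u)%g.
  by rewrite sdaX natr_Zp.
rewrite morphV ?inE // morphX ?inE // da.
have -> : (MkSD (u' ^+ c)%R false ^+ u)%g = MkSD (u' ^+ c * u) false.
  rewrite -[X in _ * X]natr_Zp.
  elim: (nat_of_ord u) => [|m IH]; first by rewrite mulr0.
  by rewrite expgS IH -[m.+1%:R]natr1 mulrDr mulr1 addrC.
case/MkSD_inj => + _; rewrite /= => /oppr_inj; rewrite addn1 exprSr.
have uU : u' ^+ c \is a GRing.unit by rewrite unitrX // (valP t').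
by move/(mulrI uU)/val_inj.
Qed.

Local Close Scope ring_scope.

(** * The classification *)

Theorem theorem1p1 :
  (forall (n : nat) (M : cayley_data (SD n)),
      2 <= n -> is_cayley_map M -> cm_regular M -> cm_skew_type M 3 ->
      3 %| n /\
      (n = 3 /\ cm_iso M family_a \/
       exists t : {unit 'Z_(4 * n)},
         family_b_param t /\ cm_iso M (family_b t)))
  /\
  (forall (n : nat) (t : {unit 'Z_(4 * n)}),
      2 <= n -> family_b_param t -> ~ cm_iso family_a (family_b t))
  /\
  (forall (n : nat) (t : {unit 'Z_(4 * n)})
          (n' : nat) (t' : {unit 'Z_(4 * n')}),
      2 <= n -> family_b_param t -> 2 <= n' -> family_b_param t' ->
      existT (fun m : nat => {unit 'Z_(4 * m)} : Type) n t <>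
      existT (fun m : nat => {unit 'Z_(4 * m)} : Type) n' t' ->
      ~ cm_iso (family_b t) (family_b t')).
Proof.
split; last split.
- move=> n M n_gt1 isM _ [phi [phiE index3]].
  have [n3 a3K [v hv vK]] := index3_SD n_gt1 index3.
  split=> //; have S := skew_morphism_orbit isM phiE.
  have kerL g : g \in skew_ker phi -> mult_at phi g by move/skew_kerP.
  have one_U : (1%R : 'Z_(4 * n)) \is a GRing.unit by rewrite unitr1.
  have hv' : ((2 * n)%:R * (- v) = 0)%R by rewrite mulrN hv oppr0.
  have [u [w [x [uU hw xX D]]]] : in_family phi (cm_set M).
    (* Conjugate the reflection a^v b of the kernel to b. *)
    apply: (in_family_conj one_U hv').
    have dK := sd_affK (- v)%R one_U; have d'K := sd_affVK (- v)%R one_U.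
    have dM := sd_affM 1%R hv'.
    apply: skew_orbit_in_family => //.
    + exact: (skew_orbit_conj dK d'K dM S).
    + have <- : sd_aff 1%R (- v)%R (MkSD 3%:R%R false) = MkSD 3%:R%R false.
        by congr MkSD; rewrite /= mul1r addr0.
      by apply: mult_at_conj => //; apply: kerL.
    have <- : sd_aff 1%R (- v)%R (MkSD v true) = MkSD 0%R true.
      by congr MkSD; rewrite /= mul1r addrN.
    by apply: mult_at_conj => //; apply: kerL.
  have isoP s : uniq s -> (0 < size s)%N ->
      (forall i, sd_aff u w (iter i phi x) = nth 1%g s (i %% size s)) ->
      cm_iso M (CM [set:: s] (cycle_perm s)).
    apply: (cm_iso_cycle (sd_affK w uU) (sd_affVK w uU) (sd_affM u hw) phiE xX).
    by move=> y; apply: (so_orbit S _ xX).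
  case: D => [[n3E D] | [t pt D]]; [left | right].
    split=> //; subst n.
    by rewrite family_aE; apply: isoP => //; vm_compute.
  exists t; split=> //; have [_ odd_t _] := and3P pt.
  have s0 : (0 < 4 * #[t]%g)%N by rewrite muln_gt0 order_gt0.
  apply: isoP; rewrite ?size_mkseq ?family_b_uniq // => i.
  by rewrite D nth_mkseq ?ltn_pmod // family_b_elt_mod.
- move=> n t n_gt1 /and3P[_ odd_t _]; exact: cm_iso_family_a_b.
move=> n t n' t' n_gt1 /and3P[_ odd_t _] n'_gt1 /and3P[_ odd_t' _] neq iso.
have En : n = n'.
  case: (iso) => d [/isomP[inj_d dT] _ _].
  have := card_injm inj_d (subxx _); rewrite dT !cardsT !card_SD //; lia.
by subst n'; apply: neq; rewrite (cm_iso_family_b n_gt1 odd_t odd_t' iso).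
Qed.
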